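(* Let $r\ge 3$ and $d\ge 4$ be integers and let $$k(r,d):=\left\lfloor \frac{1}{r+1}\binom{r+d}{r}-\frac{1}{r+1}\binom{r+d-2}{r}\right\rfloor-(r-2).$$ For every integer $0\le k\le k(r,d)$, the linear system $\mathcal{L}_{r,d}(d-1,2^{k})$ of hypersurfaces of degree $d$ in $\mathbb{P}^r$ with one point of multiplicity at least $d-1$ and $k$ points of multiplicity at least $2$, all points being general, is non-special and has virtual dimension at least $-1$.
   Context: We work over the complex numbers. $\mathcal{L}_{r,d}(m_1,\dots,m_n)$ denotes the linear system of degree $d$ hypersurfaces of $\mathbb{P}^r$ having multiplicity at least $m_i$ at $p_i$, $i=1,\dots,n$, where $p_1,\dots,p_n\in\mathbb{P}^r$ are in general position; exponents denote repetition. Its dimension is the projective dimension, the empty system having dimension $-1$. The virtual dimension is $v(\mathcal{L})=\binom{r+d}{r}-1-\sum_i\binom{r+m_i-1}{r}$, the expected dimension is $e(\mathcal{L})=\max\{v(\mathcal{L}),-1\}$; $\mathcal{L}$ is non-special if $\dim\mathcal{L}=e(\mathcal{L})$. *)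

(* Defs.v *)
From HB Require Import structures.
From mathcomp Require Import all_boot all_order all_algebra.
From mathcomp Require Import mpoly.
From mathcomp Require Export complex reals.

Set Implicit Arguments.
Unset Strict Implicit.
Unset Printing Implicit Defensive.

Import Order.TTheory GRing.Theory Num.Theory.
Local Open Scope ring_scope.

(* A point of P^r is given by a nonzero row of homogeneous coordinates, and a
   point of (P^r)^n by an n x (r+1) matrix all of whose rows are nonzero.      *)
Definition is_config (K : numFieldType) (n r : nat) (P : 'M[K]_(n, r.+1)) : Prop :=
  forall i : 'I_n, row i P != 0.

(* Zariski topology of (P^r)^n: closed sets are the common zero loci of
   arbitrary families of multihomogeneous polynomials, i.e. polynomials in the
   n(r+1) entries of the matrix that are homogeneous in each row separately.   *)
Definition multihomog (K : numFieldType) (n r : nat)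
    (G : {mpoly K[n * r.+1]}) : Prop :=
  exists e : 'I_n -> nat, forall a : 'X_{1..(n * r.+1)}, a \in msupp G ->
    forall i : 'I_n, (\sum_(j < r.+1) a (mxvec_index i j))%N = e i.

Definition config_eval (K : numFieldType) (n r : nat)
    (P : 'M[K]_(n, r.+1)) (G : {mpoly K[n * r.+1]}) : K :=
  G.@[fun k => mxvec P 0 k].

Definition zariski_closed (K : numFieldType) (n r : nat)
    (Z : 'M[K]_(n, r.+1) -> Prop) : Prop :=
  exists S : {mpoly K[n * r.+1]} -> Prop,
    (forall G, S G -> multihomog G) /\
    (forall P, is_config P -> (Z P <-> forall G, S G -> config_eval P G = 0)).

Definition zariski_open (K : numFieldType) (n r : nat)
    (U : 'M[K]_(n, r.+1) -> Prop) : Prop :=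
  zariski_closed (fun P => ~ U P).

Definition for_general_points (K : numFieldType) (n r : nat)
    (Q : 'M[K]_(n, r.+1) -> Prop) : Prop :=
  exists U : 'M[K]_(n, r.+1) -> Prop,
    [/\ zariski_open U,
        exists P, is_config P /\ U P
      & forall P, is_config P -> U P -> Q P].

(* As K has characteristic 0, F has multiplicity at least m at p exactly when
   all its partial derivatives of order less than m vanish at p.               *)
Definition mult_at_least (K : numFieldType) (r : nat)
    (F : {mpoly K[r.+1]}) (p : 'rV[K]_r.+1) (m : nat) : Prop :=
  forall a : 'X_{1..r.+1}, (mdeg a < m)%N -> (F^`M[a]).@[fun j => p 0 j] = 0.

Definition pderiv_at (K : numFieldType) (r d : nat) (a : 'X_{1..r.+1})
    (p : 'rV[K]_r.+1) (F : dhomog r.+1 K d) : K^o :=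
  ((mpoly_of_dhomog F)^`M[a]).@[fun j => p 0 j].

Fact pderiv_at_is_linear (K : numFieldType) (r d : nat) (a : 'X_{1..r.+1})
    (p : 'rV[K]_r.+1) : linear (@pderiv_at K r d a p).
Proof.
by move=> c F G; rewrite /pderiv_at !raddfD /= mderivmZ mevalZ.
Qed.

HB.instance Definition _ (K : numFieldType) (r d : nat) (a : 'X_{1..r.+1})
    (p : 'rV[K]_r.+1) :=
  GRing.isLinear.Build K (dhomog r.+1 K d) K^o _ (@pderiv_at K r d a p)
    (pderiv_at_is_linear a p).

(* The vector space of forms F of degree d with multiplicity at least m_i at
   P_i for all i (see linsysP); the linear system is its projectivization.     *)
Definition linsys (K : numFieldType) (n r d : nat) (m : n.-tuple nat)
    (P : 'M[K]_(n, r.+1)) : {vspace dhomog r.+1 K d} :=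
  (\bigcap_(i < n) \bigcap_(a : 'X_{1..r.+1 < tnth m i})
     lker (linfun (@pderiv_at K r d a (row i P))))%VS.

Lemma linsysP (K : numFieldType) (n r d : nat) (m : n.-tuple nat)
    (P : 'M[K]_(n, r.+1)) (F : dhomog r.+1 K d) :
  F \in linsys d m P <->
  forall i : 'I_n, mult_at_least (mpoly_of_dhomog F) (row i P) (tnth m i).
Proof.
rewrite memvE; split.
  move=> /subv_bigcapP FP i a lta.
  have /subv_bigcapP/(_ (BMultinom lta) isT) := FP i isT.
  by rewrite -memvE memv_ker lfunE => /eqP.
move=> FP; apply/subv_bigcapP => i _; apply/subv_bigcapP => a _.
by rewrite -memvE memv_ker lfunE; apply/eqP/FP/bmdeg.
Qed.

Definition linsys_dim (K : numFieldType) (n r d : nat) (m : n.-tuple nat)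
    (P : 'M[K]_(n, r.+1)) : int :=
  (\dim (linsys d m P))%:Z - 1.

Definition virtual_dim (n r d : nat) (m : n.-tuple nat) : int :=
  'C(r + d, r)%:Z - 1 - \sum_(i < n) 'C((r + tnth m i).-1, r)%:Z.

Definition expected_dim (n r d : nat) (m : n.-tuple nat) : int :=
  Num.max (virtual_dim r d m) (-1).

Definition non_special (K : numFieldType) (n r d : nat) (m : n.-tuple nat) : Prop :=
  for_general_points (fun P : 'M[K]_(n, r.+1) =>
    linsys_dim d m P = expected_dim r d m).

Definition k_bound (r d : nat) : int :=
  Num.floor (r.+1%:R^-1 * 'C(r + d, r)%:R
             - r.+1%:R^-1 * 'C(r + d - 2, r)%:R : rat) - (r%:Z - 2).

Definition mults (d k : nat) : k.+1.-tuple nat := [tuple of d.-1 :: nseq k 2%N].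

(* Main.v *)
Require Import Defs.
From HB Require Import structures.
From mathcomp Require Import all_boot all_order all_algebra all_fingroup.
From mathcomp Require Import mpoly.
From mathcomp Require Import complex reals.
From mathcomp Require Import ring zify.

(** Put the point of multiplicity d-1 at a coordinate point: the forms in question
    are x0 A + B with A, B free of x0, a space of dimension u(r,d) with
    u(r,d) = u(r-1,d) + u(r,d-1).  Independence of the double point conditions is
    proved by induction on r and d (Horace's method).  Specialise as many points as
    induction allows to a hyperplane through the first point: the trace is the same
    problem in P^(r-1), and the residual is the problem in degree d-1 for the
    remaining q double points, plus simple points on the hyperplane.  Those simple
    points are harmless as soon as the forms of degree d-2 singular at the q points
    form a space of dimension at most r-1; this holds because beyond the bound for
    degree d-2 every further general double point lowers the dimension by at least 2.
    The slack r-2 in k(r,d) is what makes the numbers fit.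

    The induction starts from the plane and from cubics.  For cubics one passes from
    n to n+3 variables: besides the new coordinate points one adds points e_j + y_j, where
    e_j runs over about 3n/4 of the old coordinate points and y_j lies in the three new
    directions.  Their conditions essentially bear on the three quadrics multiplying the
    new variables, and these quadrics still have room for the simple conditions imposed
    by the old points.

    One good configuration suffices: the conditions at P form a matrix whose columns
    are homogeneous in one row of P each, and the nonvanishing of one of its maximal
    minors is the required open condition. *)

Set Implicit Arguments.
Unset Strict Implicit.
Unset Printing Implicit Defensive.

Import Order.TTheory GRing.Theory Num.Theory.
Local Open Scope ring_scope.
Local Open Scope complex_scope.

(** * The forms x0 A + B *)

(* Coordinates are listed newest first, and x0 is the last one.  A monomial of degree
   [d] with x0-degree at most 1 is either free of the newest variable or a multiple of
   it; [slab_mono] lists all of them in this order, evaluated at a point, and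
   [slab_jac] lists their gradients.  The ring is arbitrary so that the point may have
   polynomial coordinates. *)
Fixpoint slab_dim (r d : nat) {struct r} : nat :=
  match r with
  | 0 => (d <= 1)%N
  | r'.+1 => (fix aux d := match d with
                           | 0 => 1
                           | d'.+1 => slab_dim r' d'.+1 + aux d'
                           end) d
  end%N.

Definition row_tail (R : Type) r (p : 'rV[R]_r.+2) : 'rV[R]_r.+1 :=
  @rsubmx R 1 1 r.+1 p.

Fixpoint slab_mono (R : comNzRingType) (r d : nat) {struct r} :
    'rV[R]_r.+1 -> 'cV[R]_(slab_dim r d) :=
  match r with
  | 0 => fun p => const_mx (if d == 0%N then 1 else p 0 0)
  | r'.+1 => (fix aux d : 'rV[R]_r'.+2 -> 'cV[R]_(slab_dim r'.+1 d) :=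
      match d with
      | 0 => fun _ => const_mx 1
      | d'.+1 => fun p =>
          col_mx (slab_mono d'.+1 (row_tail p)) (p 0 0 *: aux d' p)
      end) d
  end.

Fixpoint slab_jac (R : comNzRingType) (r d : nat) {struct r} :
    'rV[R]_r.+1 -> 'M[R]_(slab_dim r d, r.+1) :=
  match r with
  | 0 => fun _ => const_mx (d != 0%N)%:R
  | r'.+1 => (fix aux d : 'rV[R]_r'.+2 -> 'M[R]_(slab_dim r'.+1 d, r'.+2) :=
      match d with
      | 0 => fun _ => 0
      | d'.+1 => fun p =>
          col_mx (row_mx (0 : 'cV_(slab_dim r' d'.+1)) (slab_jac d'.+1 (row_tail p)))
                 (p 0 0 *: aux d' p
                  + slab_mono d' p *m (delta_mx 0 0 : 'rV_r'.+2))
      end) d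
  end.

Section Basic.
Variable R : comNzRingType.

Lemma slab_dimS r d : slab_dim r.+1 d.+1 = (slab_dim r d.+1 + slab_dim r.+1 d)%N.
Proof. by []. Qed.

Lemma slab_monoS r d (p : 'rV[R]_r.+2) :
  slab_mono d.+1 p = col_mx (slab_mono d.+1 (row_tail p)) (p 0 0 *: slab_mono d p).
Proof. by []. Qed.

Lemma slab_jacS r d (p : 'rV[R]_r.+2) :
  slab_jac d.+1 p = col_mx (row_mx (0 : 'cV_(slab_dim r d.+1)) (slab_jac d.+1 (row_tail p)))
                 (p 0 0 *: slab_jac d p + slab_mono d p *m (delta_mx 0 0 : 'rV_r.+2)).
Proof. by []. Qed.

Lemma slab_jac0 r (p : 'rV[R]_r.+1) : slab_jac 0 p = 0.
Proof. by case: r p => [|r] p //=; apply/matrixP=> i j; rewrite !mxE. Qed.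

Lemma row_tailE r (p : 'rV[R]_r.+2) j : row_tail p 0 j = p 0 (lift ord0 j).
Proof. by rewrite mxE; congr (p _ _); apply: val_inj. Qed.

Lemma row_tail_split r (p : 'rV[R]_r.+2) : p = row_mx (p 0 0)%:M (row_tail p).
Proof.
apply/rowP=> j; rewrite mxE; case: splitP => k /= Hk.
  by rewrite ord1 mxE eqxx; congr (p _ _); apply: val_inj => /=; rewrite Hk ord1.
by rewrite row_tailE; congr (p _ _); apply: val_inj.
Qed.

Lemma row_tail_row r (x : 'M[R]_1) (y : 'rV[R]_r.+1) :
  row_tail (row_mx x y : 'rV_r.+2) = y.
Proof. exact: row_mxKr. Qed.

Lemma head_row r (x : 'M[R]_1) (y : 'rV[R]_r.+1) :
  (row_mx x y : 'rV_r.+2) 0 0 = x 0 0.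
Proof.
rewrite mxE; case: splitP => k //= Hk; first by rewrite ord1.
Qed.

Lemma head_row0 r (y : 'rV[R]_r.+1) : (row_mx (0 : 'M_1) y : 'rV_r.+2) 0 0 = 0.
Proof. by rewrite head_row mxE. Qed.

Lemma row_tail_map (S : comNzRingType) (f : R -> S) r (p : 'rV[R]_r.+2) :
  row_tail (map_mx f p) = map_mx f (row_tail p).
Proof. by apply/rowP=> j; rewrite !mxE. Qed.

(** Euler's identity, for all monomials at once. Through it the gradient of a form of positive
    degree determines its value. *)
Lemma slab_euler r d (p : 'rV[R]_r.+1) :
  slab_jac d p *m p^T = d%:R *: slab_mono d p.
Proof.
elim: r d p => [|r IHr] d p.
  apply/colP=> i; rewrite !mxE big_ord1 !mxE.
  case: d i => [|[|d]] [i lti] //=; first by rewrite !mul0r.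
elim: d => [|d IHd]; first by rewrite slab_jac0 mul0mx scale0r.
rewrite slab_jacS slab_monoS mul_col_mx scale_col_mx; congr col_mx.
  by rewrite [in p^T](row_tail_split p) (@tr_row_mx _ 1 1 r.+1) (@mul_row_col _ _ 1) mul0mx add0r IHr.
rewrite mulmxDl -scalemxAl IHd -mulmxA -rowE.
have -> : row 0 p^T = (p 0 0)%:M.
  by apply/matrixP=> i j; rewrite !ord1 !mxE eqxx.
rewrite mul_mx_scalar !scalerA -scalerDl; congr (_ *: _).
by rewrite mulrSr; ring.
Qed.

(** The chain rule, for any derivation: it serves for the derivative along a line and for the
    partial derivatives of multivariate polynomials. *)
Lemma slab_mono_deriv (D : {additive R -> R})
    (DM : forall a b, D (a * b) = D a * b + a * D b) r d (p : 'rV[R]_r.+1) :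
  map_mx D (slab_mono d p) = slab_jac d p *m (map_mx D p)^T.
Proof.
have D1 : D 1 = 0.
  by apply: (addrI (D 1)); rewrite addr0 -[in RHS](mulr1 1) DM mulr1 mul1r.
elim: r d p => [|r IHr] d p.
  apply/colP=> i; rewrite !mxE big_ord1 !mxE.
  by case: d i => [|[|d]] [i lti] //=; rewrite ?mul0r ?mul1r.
elim: d => [|d IHd].
  by rewrite slab_jac0 mul0mx; apply/matrixP=> i j; rewrite !mxE.
rewrite slab_jacS slab_monoS mul_col_mx map_col_mx; congr col_mx.
  rewrite IHr [map_mx D p]row_tail_split row_tail_map (@tr_row_mx _ 1 1 r.+1) (@mul_row_col _ _ 1).
  by rewrite mul0mx add0r.
rewrite mulmxDl -scalemxAl -IHd -mulmxA -rowE.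
by apply/colP=> i; rewrite !mxE big_ord1 !mxE DM addrC [D _ * _]mulrC.
Qed.

End Basic.

Lemma map_slab_mono (R S : comNzRingType) (f : {rmorphism R -> S}) r d (p : 'rV[R]_r.+1) :
  map_mx f (slab_mono d p) = slab_mono d (map_mx f p).
Proof.
elim: r d p => [|r IHr] d p.
  by rewrite /= map_const_mx; case: eqP => _; rewrite ?rmorph1 // mxE.
elim: d => [|d IHd]; first by rewrite /= map_const_mx rmorph1.
rewrite !slab_monoS map_col_mx map_mxZ IHr IHd mxE; congr (col_mx (slab_mono _ _) _).
by apply/rowP=> j; rewrite !mxE.
Qed.

Lemma map_slab_jac (R S : comNzRingType) (f : {rmorphism R -> S}) r d (p : 'rV[R]_r.+1) :
  map_mx f (slab_jac d p) = slab_jac d (map_mx f p).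
Proof.
elim: r d p => [|r IHr] d p; first by rewrite /= map_const_mx rmorph_nat.
elim: d => [|d IHd]; first by rewrite !slab_jac0 map_mx0.
rewrite !slab_jacS (@map_col_mx _ _ f (slab_dim r d.+1) (slab_dim r.+1 d)).
rewrite (@map_row_mx _ _ f _ 1 r.+1) map_mx0 IHr map_mxD map_mxZ map_mxM.
by rewrite map_slab_mono IHd map_delta_mx mxE row_tail_map.
Qed.

Section Coeff.
Variable R : comNzRingType.

(* Coefficient rows of [F0 + x * G], with [F0] free of the new variable [x]. *)
Definition rcat r d (c0 : 'rV[R]_(slab_dim r d.+1)) (c1 : 'rV[R]_(slab_dim r.+1 d)) :
  'rV[R]_(slab_dim r.+1 d.+1) := row_mx c0 c1.

Lemma rcatP r d (c : 'rV[R]_(slab_dim r.+1 d.+1)) : exists c0 c1, c = rcat c0 c1.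
Proof.
exists (@lsubmx _ 1 (slab_dim r d.+1) (slab_dim r.+1 d) c).
exists (@rsubmx _ 1 (slab_dim r d.+1) (slab_dim r.+1 d) c).
by rewrite /rcat hsubmxK.
Qed.

Lemma rcat_slab_mono r d c0 c1 (p : 'rV[R]_r.+2) :
  rcat c0 c1 *m slab_mono d.+1 p =
  c0 *m slab_mono d.+1 (row_tail p) + p 0 0 *: (c1 *m slab_mono d p).
Proof.
by rewrite slab_monoS /rcat (@mul_row_col _ _ (slab_dim r d.+1) (slab_dim r.+1 d)) -scalemxAr.
Qed.

Lemma rcat_slab_jac r d c0 c1 (p : 'rV[R]_r.+2) :
  rcat c0 c1 *m slab_jac d.+1 p =
  row_mx (0 : 'M_1) (c0 *m slab_jac d.+1 (row_tail p)) + p 0 0 *: (c1 *m slab_jac d p)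
  + (c1 *m slab_mono d p) 0 0 *: delta_mx 0 0.
Proof.
rewrite slab_jacS /rcat (@mul_row_col _ _ (slab_dim r d.+1) (slab_dim r.+1 d)).
rewrite (@mul_mx_row _ _ _ 1 r.+1) mulmx0 mulmxDr -scalemxAr mulmxA addrA.
by rewrite [X in _ + X *m _]mx11_scalar mul_scalar_mx.
Qed.

End Coeff.

(** * Conditions that are open along lines *)

Section LineOpen.
Variable K : numFieldType.

Lemma poly_nonroot (g : {poly K}) : g != 0 -> exists t, g.[t] != 0.
Proof.
move=> g0; pose rs : seq K := [seq i%:R | i <- iota 0 (size g)].
have [/allP rsP|/allPn[t _ gt]] := boolP (all (root g) rs); last by exists t.
have urs : uniq rs.
  by rewrite map_inj_uniq ?iota_uniq // => i j /eqP; rewrite eqr_nat => /eqP.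
have := max_poly_roots g0 (introT allP rsP) urs.
by rewrite size_map size_iota ltnn.
Qed.

(* A nonempty condition of this kind holds at all but finitely many points of any line
   through one of its points, so two nonempty ones hold simultaneously somewhere. *)
Definition line_open k n (Q : 'M[K]_(k, n) -> Prop) :=
  forall A B, Q A -> exists2 g : {poly K}, g != 0 &
    forall t, g.[t] != 0 -> Q (A + t *: (B - A)).

Lemma line_open_and k n (Q Q' : 'M[K]_(k, n) -> Prop) :
  line_open Q -> line_open Q' -> line_open (fun A => Q A /\ Q' A).
Proof.
move=> oQ oQ' A B [QA Q'A].
have [g g0 gP] := oQ A B QA; have [g' g'0 g'P] := oQ' A B Q'A.
exists (g * g'); first by rewrite mulf_neq0.
by move=> t; rewrite hornerM mulf_eq0 negb_or => /andP[/gP ? /g'P ?].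
Qed.

Lemma line_open_meet k n (Q Q' : 'M[K]_(k, n) -> Prop) A B :
  line_open Q -> line_open Q' -> Q A -> Q' B -> exists C, Q C /\ Q' C.
Proof.
move=> oQ oQ' QA Q'B.
have [g g0 gP] := oQ A B QA; have [g' g'0 g'P] := oQ' B A Q'B.
(* Substituting 1 - X reads the line from [B] to [A] with the parameter of the line from [A] to
   [B]. *)
have n0 : g * (g' \Po (1 - 'X)) != 0.
  rewrite mulf_neq0 // -size_poly_eq0 size_comp_poly2 ?size_poly_eq0 //.
  by rewrite -opprB size_polyN size_XsubC.
have [t] := poly_nonroot n0.
rewrite hornerM mulf_eq0 negb_or horner_comp => /andP[gt g't].
exists (A + t *: (B - A)); split; first exact: gP.
have := g'P _ g't; congr (Q' _).
rewrite !hornerE; apply/matrixP=> i j; rewrite !mxE; ring.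
Qed.

Definition linepoly k n (A B : 'M[K]_(k, n)) : 'M[{poly K}]_(k, n) :=
  map_mx polyC A + 'X *: map_mx polyC (B - A).

Lemma linepolyE k n (A B : 'M[K]_(k, n)) t :
  map_mx (horner_eval t) (linepoly A B) = A + t *: (B - A).
Proof. by apply/matrixP=> i j; rewrite !mxE /horner_eval !hornerE. Qed.

Lemma map_polyC_eval k n (A : 'M[K]_(k, n)) t :
  map_mx (horner_eval t) (map_mx polyC A) = A.
Proof. by apply/matrixP=> i j; rewrite !mxE /horner_eval hornerC. Qed.

(** Certifies a rank bound by constant matrices; the bound persists as long as the determinant of
    the product stays nonzero. *)
Lemma mxrank_witness a b (M : 'M[K]_(a, b)) m : (m <= \rank M)%N ->
  exists L N, L *m M *m N = 1%:M :> 'M_m.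
Proof.
move=> lem; exists (pid_mx m *m invmx (col_ebase M)).
exists (invmx (row_ebase M) *m pid_mx m).
rewrite -{2}(mulmx_ebase M) !mulmxA mulmxKV ?col_ebase_unit //.
rewrite -!mulmxA (mulmxA (row_ebase M)) mulmxV ?row_ebase_unit // mul1mx.
have [la lb] : (\rank M <= a /\ \rank M <= b)%N by rewrite rank_leq_row rank_leq_col.
rewrite !mul_pid_mx -[RHS]pid_mx_1.
by apply/matrixP=> i j; rewrite !mxE; do !congr (nat_of_bool _)%:R; lia.
Qed.

(** With [L] and [N] frozen at [A], the determinant is a polynomial along the line with value 1 at
    parameter 0. [FP] is [F] over the polynomial ring. *)
Lemma line_open_rank k n a b (F : 'M[K]_(k, n) -> 'M[K]_(a, b))
    (FP : 'M[{poly K}]_(k, n) -> 'M[{poly K}]_(a, b)) m :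
  (forall t X, map_mx (horner_eval t) (FP X) = F (map_mx (horner_eval t) X)) ->
  line_open (fun A => m <= \rank (F A))%N.
Proof.
move=> FPE A B /mxrank_witness[L [N LN]].
pose g := \det (map_mx polyC L *m FP (linepoly A B) *m map_mx polyC N).
have gE t : g.[t] = \det (L *m F (A + t *: (B - A)) *m N).
  rewrite -[g.[t]]/(horner_eval t g) -det_map_mx !map_mxM.
  by rewrite FPE linepolyE !map_polyC_eval.
exists g.
  by apply: contraTneq (oner_neq0 K) => g0; rewrite -(det1 _ m) -LN
    -[A](addr0) -(scale0r (B - A)) -gE g0 horner0 eqxx.
move=> t; rewrite gE => dN.
have /mxrank_unit <- : L *m F (A + t *: (B - A)) *m N \in unitmx.
  by rewrite unitmxE unitfE.
exact: leq_trans (mxrankM_maxl _ _) (mxrankM_maxr _ _).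
Qed.

End LineOpen.

(** * Matrices of double point and simple point conditions *)

Section Points.
Variable R : comNzRingType.

(** All gradients side by side: the left kernel consists of the forms with zero gradient at every
    point, and full column rank means that the double point conditions are independent. *)
Definition slab_jacs k r d (P : 'M[R]_(k, r.+1)) : 'M[R]_(slab_dim r d, k * r.+1) :=
  \matrix_(a, b) mxvec (\matrix_(i < k, l < r.+1) slab_jac d (row i P) a l) 0 b.

Definition slab_monos k r d (P : 'M[R]_(k, r.+1)) : 'M[R]_(slab_dim r d, k) :=
  \matrix_(a, i) slab_mono d (row i P) a 0.

Lemma mul_slab_jacs k r d (P : 'M[R]_(k, r.+1)) (c : 'rV_(slab_dim r d)) :
  c *m slab_jacs d P = mxvec (\matrix_i (c *m slab_jac d (row i P))).
Proof.
apply/rowP=> b; case/mxvec_indexP: b => i l; rewrite mxvecE !mxE.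
by apply: eq_bigr => a _; rewrite !mxE mxvecE mxE.
Qed.

Lemma mul_slab_monos k r d (P : 'M[R]_(k, r.+1)) (c : 'rV_(slab_dim r d)) i :
  (c *m slab_monos d P) 0 i = (c *m slab_mono d (row i P)) 0 0.
Proof. by rewrite !mxE; apply: eq_bigr => a _; rewrite !mxE. Qed.

End Points.

Lemma map_slab_jacs (R S : comNzRingType) (f : {rmorphism R -> S}) k r d
    (P : 'M[R]_(k, r.+1)) : map_mx f (slab_jacs d P) = slab_jacs d (map_mx f P).
Proof.
apply/matrixP=> a b; case/mxvec_indexP: b => i l; rewrite !mxE !mxvecE !mxE.
by rewrite -map_row -map_slab_jac mxE.
Qed.

Lemma map_slab_monos (R S : comNzRingType) (f : {rmorphism R -> S}) k r d
    (P : 'M[R]_(k, r.+1)) : map_mx f (slab_monos d P) = slab_monos d (map_mx f P).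
Proof. by apply/matrixP=> a b; rewrite !mxE -map_row -map_slab_mono mxE. Qed.

Section Slab.
Variable K : numFieldType.

Lemma line_open_jacs k r d m :
  line_open (fun P : 'M[K]_(k, r.+1) => m <= \rank (slab_jacs d P))%N.
Proof.
by apply: (line_open_rank (FP := fun P => slab_jacs d P)) => t X; rewrite map_slab_jacs.
Qed.

Lemma line_open_monos k r d m a (A : 'M[K]_(a, slab_dim r d)) :
  line_open (fun P : 'M[K]_(k, r.+1) => m <= \rank (A *m slab_monos d P))%N.
Proof.
apply: (line_open_rank (FP := fun P => map_mx polyC A *m slab_monos d P)) => t X.
by rewrite map_mxM map_polyC_eval map_slab_monos.
Qed.

Lemma line_open_head k r :
  line_open (fun P : 'M[K]_(k, r.+1) => forall i, P i 0 != 0).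
Proof.
move=> A B A0; exists (\prod_i linepoly A B i 0).
  apply/prodf_neq0 => i _; apply: contraNneq (A0 i) => l0.
  by move: (congr1 (horner_eval 0) l0); rewrite !mxE /horner_eval !hornerE => ->.
move=> t; rewrite horner_prod => /prodf_neq0 h i.
move: (h i isT); apply: contra_neq.
by rewrite !mxE !hornerE.
Qed.

Definition grad_surj k r d (P : 'M[K]_(k, r.+1)) :=
  forall W : 'M[K]_(k, r.+1), exists c : 'rV_(slab_dim r d),
  forall i, c *m slab_jac d (row i P) = row i W.

Lemma row_full_surj a b (M : 'M[K]_(a, b)) :
  (b <= \rank M)%N <-> forall w : 'rV_b, exists c, c *m M = w.
Proof.
split=> [leb w|MP].
  have /submxP[c ->] : (w <= M)%MS by apply: submx_full; rewrite -col_leq_rank.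
  by exists c.
rewrite col_leq_rank -sub1mx; apply/row_subP => i.
by have [c <-] := MP (row i 1%:M); apply: submxMl.
Qed.

Lemma grad_surjP k r d (P : 'M[K]_(k, r.+1)) :
  grad_surj d P <-> (k * r.+1 <= \rank (slab_jacs d P))%N.
Proof.
rewrite row_full_surj; split=> [sP w|sP W].
  have [c cP] := sP (vec_mx w); exists c.
  by rewrite mul_slab_jacs -[w]vec_mxK; congr mxvec; apply/row_matrixP=> i; rewrite rowK cP.
have [c] := sP (mxvec W); rewrite mul_slab_jacs => /(can_inj mxvecK) cW; exists c => i.
by rewrite -cW rowK.
Qed.

Lemma sub_ker_slab_jacs k r d (P : 'M[K]_(k, r.+1)) (c : 'rV_(slab_dim r d)) :
  (c <= kermx (slab_jacs d P))%MS <-> forall i, c *m slab_jac d (row i P) = 0.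
Proof.
rewrite sub_kermx mul_slab_jacs; split=> [/eqP/(congr1 vec_mx)|c0].
  by rewrite mxvecK linear0 => /row_matrixP c0 i; have := c0 i; rewrite rowK row0.
apply/eqP; rewrite -[RHS](linear0 mxvec); congr mxvec.
by apply/row_matrixP=> i; rewrite rowK row0.
Qed.

(* [corank_le r d k z]: for some [k] points, the forms singular at all of them form a
   space of dimension at most [z]. *)
Definition indep_points r d k := exists P : 'M[K]_(k, r.+1), grad_surj d P.
Definition corank_le r d k z :=
  exists P : 'M[K]_(k, r.+1), (slab_dim r d <= \rank (slab_jacs d P) + z)%N.

Lemma indep_corank r d k z : indep_points r d k -> (slab_dim r d <= k * r.+1 + z)%N -> corank_le r d k z.
Proof. by move=> [P /grad_surjP sP] ?; exists P; lia. Qed.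

Lemma corank_le_weaken r d k z z' : (z <= z')%N -> corank_le r d k z -> corank_le r d k z'.
Proof. by move=> ? [P ?]; exists P; lia. Qed.

Lemma indep_points_le r d k k' : (k' <= k)%N -> indep_points r d k -> indep_points r d k'.
Proof.
move=> le [P sP]; exists (rowsub (widen_ord le) P) => W.
have [c cW] := sP (\matrix_i (if insub (i : nat) is Some j then row j W else 0)).
exists c => i; rewrite row_rowsub cW rowK /=.
by rewrite insubT // => lti; congr (row _ _); apply: val_inj.
Qed.

(** Setting the newest variable to 0 isolates [c0]; if [c0] is zero, the form is that variable times
    [c1], and a point off the hyperplane is sought. *)
Lemma slab_mono_neq0 r d (c : 'rV[K]_(slab_dim r d)) : c != 0 ->
  exists p : 'rV[K]_r.+1, (c *m slab_mono d p) 0 0 != 0.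
Proof.
have mE r' d' (c' : 'rV[K]_(slab_dim r' d')) (p : 'rV[K]_r'.+1) :
    (c' *m slab_monos d' p) 0 0 = (c' *m slab_mono d' p) 0 0.
  by rewrite mul_slab_monos; congr ((_ *m slab_mono _ _) _ _); apply/rowP=> i; rewrite mxE.
elim: r d c => [|r IHr] d c.
  have small : (slab_dim 0 d <= 1)%N by apply: leq_b1.
  move=> c0; exists (const_mx 1); case/rV0Pn: c0 => i ci.
  have uniq_i (j : 'I_(slab_dim 0 d)) : j = i.
    by apply: ord_inj; have := ltn_ord j; have := ltn_ord i; lia.
  rewrite mxE (bigD1 i) //= big1 ?addr0; last by move=> j; rewrite (uniq_i j) eqxx.
  by rewrite !mxE if_same mulr1.
elim: d c => [|d IHd] c.
  move=> c0; exists 0; rewrite mxE big_ord1 mxE mulr1.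
  by case/rV0Pn: c0 => i; rewrite ord1.
have [c0 [c1 ->]] := rcatP c.
have [->|c0n] := eqVneq c0 0; last first.
  move=> _; have [y yP] := IHr _ _ c0n; exists (row_mx (0 : 'M_1) y).
  by rewrite rcat_slab_mono head_row0 scale0r addr0 row_tail_row.
have [->|c1n] := eqVneq c1 0; first by rewrite /rcat row_mx0 eqxx.
move=> _; have [p pP] := IHd _ c1n.
have [] := @line_open_meet K 1 r.+2 _ _ p (const_mx 1) (@line_open_monos 1 _ d 1 _ c1)
   (@line_open_head 1 _).
- rewrite lt0n mxrank_eq0; apply: contra_neq pP => m0.
  by rewrite -mE m0 mxE.
- by move=> i; rewrite mxE oner_eq0.
move=> p' [cp' p'0]; exists p'.
rewrite rcat_slab_mono mul0mx add0r mxE mulf_neq0 ?p'0 //.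
rewrite -mE; apply: contraTneq cp' => m0; rewrite -leqNgt leqn0 mxrank_eq0.
by apply/eqP/rowP=> i; rewrite ord1 m0 mxE.
Qed.

(** Points are chosen one at a time: some nonzero form of the space vanishes at all points chosen so
    far, and the next point is one where it does not. The map [phi] covers both slab forms and
    quadrics. *)
Lemma eval_points_gen n N (phi : 'rV[K]_n -> 'cV[K]_N) a (A : 'M[K]_(a, N)) k :
  (forall c : 'rV_N, (c <= A)%MS -> c != 0 -> exists p, (c *m phi p) 0 0 != 0) ->
  (k <= \rank A)%N ->
  exists Y : 'M[K]_(k, n),
    (k <= \rank (A *m \matrix_(i, j) phi (row j Y) i 0)%R)%N.
Proof.
move=> nv; pose ph k (Y : 'M[K]_(k, n)) : 'M[K]_(N, k) := \matrix_(i, j) phi (row j Y) i 0.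
have mul_ph k' (Y : 'M_(k', n)) (c : 'rV_N) j :
    (c *m ph _ Y) 0 j = (c *m phi (row j Y)) 0 0.
  by rewrite !mxE; apply: eq_bigr => i _; rewrite !mxE.
elim: k => [|k IHk] lek; first by exists 0.
have [Y /row_full_surj Ysurj] := IHk (ltnW lek).
pose M := A *m ph _ Y.
have : kermx M *m A != 0.
  apply: contraTneq lek => /eqP; rewrite -sub_kermx => /mxrankS.
  have := rank_leq_col M; have := rank_leq_row A.
  by rewrite !mxrank_ker; lia.
case/rowV0Pn => c /submxP[u cE] c0.
have [|p pP] := nv c _ c0; first by rewrite cE mulmxA submxMl.
exists (col_mx p Y : 'M_(1 + k, n)); apply/row_full_surj => w.
have [v vP] := Ysurj (\row_j w 0 (lift ord0 j)).
(* The multiple of [c], which vanishes at the old points, that corrects the value at the new one. *)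
pose mu := (w 0 0 - (v *m A *m phi p) 0 0) / (c *m phi p) 0 0.
exists (v + mu *: (u *m kermx M)); apply/rowP=> j.
rewrite mulmxA mul_ph mulmxDl -scalemxAl -mulmxA -cE mulmxDl -scalemxAl.
case: (unliftP ord0 j) => [j'|] ->.
  have -> : row (lift ord0 j') (col_mx p Y : 'M_(1 + k, n)) = row j' Y.
    by apply/rowP=> l; rewrite !mxE; case: splitP => [[[]]|k'] //= [/val_inj ->].
  have /rowP/(_ j') := vP; rewrite mulmxA mul_ph [RHS]mxE => <-.
  have : c *m ph _ Y = 0.
    by rewrite cE -mulmxA -[kermx M *m A *m _]mulmxA mulmx_ker mulmx0.
  by move=> /rowP/(_ j'); rewrite mul_ph => c0'; rewrite mxE [X in _ + X]mxE c0' [X in mu * X]mxE mulr0 addr0.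
have -> : row ord0 (col_mx p Y : 'M_(1 + k, n)) = p.
  by apply/rowP=> l; rewrite !mxE; case: splitP => [k' _|k'] //=; rewrite ord1.
by rewrite mxE [X in _ + X]mxE /mu divfK // addrC subrK.
Qed.

Lemma eval_points r d a (A : 'M[K]_(a, slab_dim r d)) k : (k <= \rank A)%N ->
  exists Y : 'M[K]_(k, r.+1), (k <= \rank (A *m slab_monos d Y))%N.
Proof. by apply: eval_points_gen => c _ /slab_mono_neq0. Qed.

(* The gradient of [x * G] is [x * grad G + G * dx]; by Euler's identity it determines
   [grad G] as long as [x <> 0]. *)
Lemma shift_jac_ker r d (c : 'rV[K]_(slab_dim r d)) (p : 'rV[K]_r.+1) :
  p 0 0 != 0 ->
  p 0 0 *: (c *m slab_jac d p) + (c *m slab_mono d p) 0 0 *: delta_mx 0 0 = 0 ->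
  c *m slab_jac d p = 0 /\ c *m slab_mono d p = 0.
Proof.
move=> p0 eq0; have /(congr1 (mulmx^~ p^T)) := eq0.
rewrite mul0mx mulmxDl -!scalemxAl -mulmxA slab_euler -rowE -scalemxAr => /rowP/(_ 0).
rewrite !mxE -/((c *m slab_mono d p) 0 0) => e.
have m0 : c *m slab_mono d p = 0.
  apply/rowP=> i; rewrite ord1 [RHS]mxE.
  have : d.+1%:R * p 0 0 * (c *m slab_mono d p) 0 0 = 0.
    by rewrite -[RHS]e mxE mulrSr; ring.
  by move/eqP; rewrite !mulf_eq0 (negPf p0) pnatr_eq0 /= => /eqP.
split=> //; move: eq0; rewrite m0 mxE scale0r addr0 => /eqP.
by rewrite scaler_eq0 (negPf p0) => /eqP.
Qed.

Lemma shift_jac_solve r d (w : 'rV[K]_r.+1) (p : 'rV[K]_r.+1) : p 0 0 != 0 ->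
  exists v, forall c : 'rV[K]_(slab_dim r d.+1), c *m slab_jac d.+1 p = v ->
  p 0 0 *: v + (c *m slab_mono d.+1 p) 0 0 *: delta_mx 0 0 = w.
Proof.
(* Pairing the wanted identity with [p], Euler's identity forces this value of the form at [p]. *)
move=> p0; pose mu := (w *m p^T) 0 0 / (p 0 0 * d.+2%:R).
exists ((p 0 0)^-1 *: (w - mu *: delta_mx 0 0)) => c cE.
set m := (c *m slab_mono d.+1 p) 0 0.
have e : (p 0 0)^-1 * ((w *m p^T) 0 0 - mu * p 0 0) = d.+1%:R * m.
  transitivity ((c *m slab_jac d.+1 p *m p^T) 0 0); last first.
    by rewrite -mulmxA slab_euler -scalemxAr mxE.
  rewrite cE -scalemxAl mulmxBl -scalemxAl -rowE.
  rewrite [RHS]mxE; congr (_ * _); rewrite [RHS]mxE; congr (_ + _).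
  by rewrite !mxE.
have -> : m = mu.
  apply: (@mulfI _ d.+1%:R); rewrite ?pnatr_eq0 // -e /mu.
  have : d.+2%:R != 0 :> K by rewrite pnatr_eq0.
  by rewrite !mulrSr => d2; field; rewrite d2 p0.
by rewrite scalerA divff // scale1r subrK.
Qed.

End Slab.

(** * Horace's method *)

Section Horace.
Variable K : numFieldType.

Lemma row_colU m1 m2 n (A : 'M[K]_(m1, n)) (B : 'M[K]_(m2, n)) i :
  row (lshift m2 i) (col_mx A B) = row i A.
Proof. by apply/rowP=> j; rewrite !mxE; case: (split_ordP (lshift m2 i)) => k /eqP; rewrite ?eq_lshift ?eq_lrshift // => /eqP ->. Qed.

Lemma row_colD m1 m2 n (A : 'M[K]_(m1, n)) (B : 'M[K]_(m2, n)) i :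
  row (rshift m1 i) (col_mx A B) = row i B.
Proof. by apply/rowP=> j; rewrite !mxE; case: (split_ordP (rshift m1 i)) => k /eqP; rewrite ?eq_rshift ?eq_rlshift // => /eqP ->. Qed.

(* [k] of the points lie on the hyperplane where the newest variable vanishes.  For a
   form [F0 + x * G] the gradient at such a point is that of [F0] together with the
   value of [G]; the last hypothesis makes [G] flexible enough on the hyperplane. *)
Lemma indep_points_horace r d k q z : indep_points K r d.+2 k -> indep_points K r.+1 d.+1 q ->
  corank_le K r.+1 d q z -> (q * r.+2 + z + k <= slab_dim r.+1 d.+1)%N ->
  indep_points K r.+1 d.+2 (k + q).
Proof.
move=> [Y1 /grad_surjP SY1] [P1 /grad_surjP SP1] [P2 KP2] lek.
have {}KP2 : (slab_dim r.+1 d - z <= \rank (slab_jacs d P2))%N by lia.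
have [P3 SKP3] := line_open_meet (@line_open_jacs K q r.+1 d.+1 _)
  (@line_open_jacs K q r.+1 d _) SP1 KP2.
have [|P [[SP KP] hP]] := line_open_meet (B := const_mx 1)
  (line_open_and (@line_open_jacs K q r.+1 d.+1 _) (@line_open_jacs K q r.+1 d _))
  (@line_open_head K q r.+1) SKP3.
  by move=> i; rewrite mxE oner_eq0.
have {hP}hP i : row i P 0 0 != 0 by rewrite mxE.
(* [W] is the space of residual forms singular at [P], and [pr] restricts to the hyperplane. An
   element restricting to zero is the newest variable times a form of degree [d] singular at [P];
   these have dimension at most [z], so the traces have dimension at least [k]. *)
pose W := kermx (slab_jacs d.+1 P).
pose pr : 'M[K]_(slab_dim r.+1 d.+1, slab_dim r d.+1) :=
  @col_mx K (slab_dim r d.+1) (slab_dim r.+1 d) _ 1%:M 0.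
have prE c0 c1 : rcat c0 c1 *m pr = c0.
  by rewrite /rcat /pr (@mul_row_col _ _ (slab_dim r d.+1)) mulmx1 mulmx0 addr0.
have rW : (k <= \rank (W *m pr))%N.
  have := mxrank_mul_ker W pr; rewrite mxrank_ker.
  suff : (\rank (W :&: kermx pr)%MS <= z)%N.
    have := rank_leq_col (slab_jacs d.+1 P); lia.
  have inj (c : 'rV_(slab_dim r.+1 d.+1)) : (c <= W :&: kermx pr)%MS ->
      exists2 c1, c = rcat 0 c1 & (c1 <= kermx (slab_jacs d P))%MS.
    rewrite sub_capmx sub_kermx => /andP[/sub_ker_slab_jacs cW /eqP].
    have [c0 [c1 cE]] := rcatP c; rewrite cE prE => c00; exists c1.
      by rewrite c00.
    apply/sub_ker_slab_jacs => i; have := cW i; rewrite cE c00 rcat_slab_jac mul0mx row_mx0 add0r.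
    by case/shift_jac_ker.
  pose ir : 'M[K]_(slab_dim r.+1 d, slab_dim r.+1 d.+1) :=
    @row_mx K _ (slab_dim r d.+1) (slab_dim r.+1 d) 0 1%:M.
  have irE c1 : c1 *m ir = rcat 0 c1.
    by rewrite /ir /rcat (@mul_mx_row _ _ _ (slab_dim r d.+1)) mulmx0 mulmx1.
  have /mxrankS : (W :&: kermx pr <= kermx (slab_jacs d P) *m ir)%MS.
    apply/row_subP => i; have [c1 -> c1P] := inj _ (row_sub i _).
    by rewrite -irE submxMr.
  move/leq_trans; apply; apply: leq_trans (mxrankM_maxl _ _) _.
  by rewrite mxrank_ker; lia.
(* The traces of [W] take arbitrary values at suitable points of the hyperplane, and by openness
   these can also be independent for the trace problem. *)
have [Y2 SY2] := eval_points rW.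
have [Y [/grad_surjP SY /row_full_surj EY]] := line_open_meet (@line_open_jacs K k r d.+2 _)
  (@line_open_monos K k r d.+1 _ _ _) SY1 SY2.
exists (col_mx (row_mx (0 : 'cV_k) Y : 'M_(k, r.+2)) P) => T.
(* [c0] settles the gradients along the hyperplane, then [c1] those at [P]; an element of [W]
   finally corrects the values of the residual form at [Y] without changing the gradients at [P]. *)
have [c0 c0P] := SY (\matrix_i row_tail (row (lshift q i) T)).
have [V VP] : exists V : 'M[K]_(q, r.+2), forall i (c : 'rV_(slab_dim r.+1 d.+1)),
    c *m slab_jac d.+1 (row i P) = row i V ->
    rcat c0 c *m slab_jac d.+2 (row i P) = row (rshift k i) T.
  pose S i := row (rshift k i) T - row_mx (0 : 'M_1) (c0 *m slab_jac d.+2 (row_tail (row i P))).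
  have vP i := shift_jac_solve d (S i) (hP i).
  have [f fP] : exists f : 'I_q -> 'rV[K]_r.+2, forall i,
      forall c : 'rV[K]_(slab_dim r.+1 d.+1), c *m slab_jac d.+1 (row i P) = f i ->
      row i P 0 0 *: f i + (c *m slab_mono d.+1 (row i P)) 0 0 *: delta_mx 0 0 = S i.
    by apply: (fin_all_exists vP).
  exists (\matrix_i f i) => i c; rewrite rowK => cE.
  by rewrite rcat_slab_jac cE -addrA (fP i c cE) /S addrC subrK.
have /grad_surjP/(_ V)[c1 c1P] := SP.
have [u uP] := EY (\row_i ((row (lshift q i) T) 0 0
   - (c1 *m slab_mono d.+1 (row_mx (0 : 'M_1) (row i Y) : 'rV_r.+2)) 0 0)).
have uW : (u *m W <= W)%MS by apply: submxMl.
exists (rcat c0 (c1 + u *m W)) => i; case: (split_ordP i) => j ->.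
  rewrite row_colU.
  have -> : row j (row_mx (0 : 'cV_k) Y : 'M_(k, r.+2)) = row_mx (0 : 'M_1) (row j Y).
    by rewrite (@row_row_mx _ _ 1 r.+1) row0.
  rewrite rcat_slab_jac head_row0 scale0r addr0 row_tail_row c0P rowK.
  have [w0 [w1 wE]] := rcatP (u *m W).
  have e : (w0 *m slab_mono d.+1 (row j Y)) 0 0 = (u *m (W *m pr *m slab_monos d.+1 Y)) 0 j.
    by rewrite (mulmxA u (W *m pr)) (mulmxA u W) mul_slab_monos wE prE.
  rewrite uP [RHS]mxE in e.
  rewrite mulmxDl wE rcat_slab_mono head_row0 scale0r addr0 row_tail_row.
  rewrite [X in X *: delta_mx _ _]mxE e addrC subrK.
  rewrite [RHS]row_tail_split; apply/rowP=> l; rewrite !mxE.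
  case: splitP => l' ll'; rewrite !mxE ?ord1.
    have -> : l = 0 by apply: val_inj; rewrite /= ll' ord1.
    by rewrite eqxx mulr1 add0r.
  suff -> : (l == 0) = false by rewrite andbF mulr0 addr0.
  by apply/negbTE; rewrite -val_eqE /= ll'.
rewrite row_colD; apply: VP; rewrite mulmxDl c1P.
by have /sub_ker_slab_jacs-> := uW; rewrite addr0.
Qed.

End Horace.

(** * Wronskians and the gradients of two independent forms *)

Section Kernel.
Variable K : numFieldType.

(* If [f(0) <> 0] and [g(0) = 0], then [X] divides [f' g] to a higher order than [f g']. *)
Lemma wronskian_neq0 (f g : {poly K}) : f.[0] != 0 -> g != 0 -> g.[0] = 0 ->
  f * g^`() - f^`() * g != 0.
Proof.
move=> f0 g0 g00; have [m [h hN0 gE]] := multiplicity_XsubC g 0.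
rewrite g0 /= in hN0; rewrite subr0 in gE.
case: m gE => [|m] gE.
  by move: hN0; move: g00; rewrite gE expr0 mulr1 /root => ->; rewrite eqxx.
have Xm : ('X ^+ m : {poly K}) != 0 by rewrite expf_neq0 // polyX_eq0.
rewrite gE derivM derivXn /= -[_ *+ m.+1]mulr_natr exprS.
have -> : f * (h^`() * ('X * 'X^m) + h * ('X^m * m.+1%:R)) - f^`() * (h * ('X * 'X^m)) =
  'X^m * (f * h * m.+1%:R + 'X * (f * h^`() - f^`() * h)) by ring.
rewrite mulf_neq0 //; apply: contraTneq hN0 => /(congr1 (horner^~ 0)).
rewrite hornerD !hornerM hornerX mul0r addr0 -polyC_natr hornerC horner0 => /eqP.
by rewrite !mulf_eq0 (negPf f0) pnatr_eq0 orbF /= => ?; rewrite negbK.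
Qed.

Lemma slab_jac_rank1 r d (c : 'rV[K]_(slab_dim r d.+1)) (p : 'rV[K]_r.+1) :
  (c *m slab_mono d.+1 p) 0 0 != 0 -> c *m slab_jac d.+1 p != 0.
Proof.
apply: contra_neq => cJ; apply: (@mulfI _ d.+1%:R); rewrite ?pnatr_eq0 // mulr0.
have : (c *m slab_jac d.+1 p *m p^T) 0 0 = d.+1%:R * (c *m slab_mono d.+1 p) 0 0.
  by rewrite -mulmxA slab_euler -scalemxAr mxE.
by rewrite cJ mul0mx mxE.
Qed.

(* Two independent forms, restricted to a suitable line, have a nonzero Wronskian. *)
Lemma slab_jac_rank2 r d (c1 c2 : 'rV[K]_(slab_dim r d.+1)) :
  (forall a b, a *: c1 + b *: c2 = 0 -> a = 0 /\ b = 0) ->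
  exists p : 'rV[K]_r.+1, forall a b,
    (a *: c1 + b *: c2) *m slab_jac d.+1 p = 0 -> a = 0 /\ b = 0.
Proof.
move=> indep.
have c10 : c1 != 0.
  apply/eqP=> c10; have [|/eqP] := indep 1 0; last by rewrite oner_eq0.
  by rewrite c10 scaler0 scale0r addr0.
have [p0 f0] := slab_mono_neq0 c10.
pose ev (c : 'rV[K]_(slab_dim r d.+1)) p := (c *m slab_mono d.+1 p) 0 0.
(* [c3] is the combination vanishing at [p0], where [c1] does not vanish; this is the situation of
   [wronskian_neq0] on a line through [p0]. *)
pose s := ev c2 p0 / ev c1 p0; pose c3 := c2 - s *: c1.
have c3p0 : ev c3 p0 = 0.
  rewrite /ev /c3 mulmxBl -scalemxAl mxE [X in _ + X]mxE [X in - X]mxE -/(ev c1 p0).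
  by rewrite -/(ev c2 p0) /s divfK // subrr.
have c30 : c3 != 0.
  apply/eqP=> c30; have [|_ /eqP] := indep (- s) 1; last by rewrite oner_eq0.
  by rewrite scaleNr scale1r addrC.
have [p1 g1] := slab_mono_neq0 c30.
pose L := linepoly p0 p1.
pose pol (c : 'rV[K]_(slab_dim r d.+1)) := (map_mx polyC c *m slab_mono d.+1 L) 0 0.
have polE c t : (pol c).[t] = ev c (p0 + t *: (p1 - p0)).
  rewrite /ev -linepolyE -map_slab_mono -{2}(map_polyC_eval c t) -map_mxM mxE.
  by [].
have dpolE c t : (pol c)^`().[t] =
    (c *m slab_jac d.+1 (p0 + t *: (p1 - p0)) *m (p1 - p0)^T) 0 0.
  have derivM' (a b : {poly K}) : deriv (a * b) = deriv a * b + a * deriv b.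
    exact: derivM.
  have -> : (pol c)^`() = (map_mx polyC c *m (slab_jac d.+1 L *m (map_mx (@deriv K) L)^T)) 0 0.
    rewrite -(slab_mono_deriv (D := @deriv K) derivM') /pol !mxE raddf_sum /=.
    by apply: eq_bigr => i _; rewrite !mxE derivM derivC mul0r add0r.
  have -> : map_mx (@deriv K) L = map_mx polyC (p1 - p0).
    apply/rowP=> j; rewrite !mxE derivD derivM derivX !derivC.
    by rewrite mulr0 addr0 mul1r add0r.
  rewrite mulmxA -linepolyE -map_slab_jac -[in RHS](map_polyC_eval c t).
  by rewrite map_trmx -[in RHS](map_polyC_eval (p1 - p0)^T t) -!map_mxM [RHS]mxE.
have line0 : p0 + 0 *: (p1 - p0) = p0 by rewrite scale0r addr0.
have line1 : p0 + 1 *: (p1 - p0) = p1 by rewrite scale1r addrC subrK.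
have [|t] := @poly_nonroot K (pol c1 * (pol c3)^`() - (pol c1)^`() * pol c3).
  apply: wronskian_neq0; rewrite ?polE ?line0 //.
  by apply: contraNneq g1 => g0; rewrite -/(ev c3 p1) -line1 -polE g0 horner0.
rewrite hornerD hornerN !hornerM !polE !dpolE; set p := p0 + _ => wr.
exists p => a b.
have -> : a *: c1 + b *: c2 = (a + b * s) *: c1 + b *: c3.
  rewrite /c3 scalerBr scalerA scalerDl; rewrite addrACA addrC -addrA.
  by rewrite [_ + b *: c2]addrC !addrA [_ + - _]addrC addNr add0r addrC.
have [a' a'E] : exists a', a' = a + b * s by exists (a + b * s).
rewrite -a'E => comb0.
(* The value and the derivative along the line give two linear equations in [a'] and [b], with the
   Wronskian as determinant. *)
have e1 : a' * ev c1 p + b * ev c3 p = 0.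
  apply: (@mulfI _ d.+1%:R); rewrite ?pnatr_eq0 // mulr0.
  have : ((a' *: c1 + b *: c3) *m slab_jac d.+1 p *m p^T) 0 0 = 0 by rewrite comb0 mul0mx mxE.
  rewrite -mulmxA slab_euler -scalemxAr mulmxDl -!scalemxAl => <-.
  by rewrite mxE [in RHS]mxE; congr (_ * (_ + _)); rewrite mxE.
pose df (c : 'rV_(slab_dim r d.+1)) := (c *m slab_jac d.+1 p *m (p1 - p0)^T) 0 0.
have e2 : a' * df c1 + b * df c3 = 0.
  have : ((a' *: c1 + b *: c3) *m slab_jac d.+1 p *m (p1 - p0)^T) 0 0 = 0.
    by rewrite comb0 mul0mx mxE.
  by rewrite !mulmxDl -!scalemxAl => <-; rewrite mxE; congr (_ + _); rewrite mxE.
move: wr; rewrite -/(ev c1 p) -/(ev c3 p) -/(df c1) -/(df c3) => wr.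
have a'0 : a' = 0.
  apply/eqP; have : a' * (ev c1 p * df c3 - df c1 * ev c3 p) == 0.
    apply/eqP; rewrite (_ : _ * _ = (a' * ev c1 p + b * ev c3 p) * df c3
      - (a' * df c1 + b * df c3) * ev c3 p); first by rewrite e1 e2 !mul0r subrr.
    by ring.
  by rewrite mulf_eq0 (negPf wr) orbF.
have b0 : b = 0.
  apply/eqP; have : b * (ev c1 p * df c3 - df c1 * ev c3 p) == 0.
    apply/eqP; rewrite (_ : _ * _ = (a' * df c1 + b * df c3) * ev c1 p
      - (a' * ev c1 p + b * ev c3 p) * df c1); first by rewrite e1 e2 !mul0r subrr.
    by ring.
  by rewrite mulf_eq0 (negPf wr) orbF.
by move: a'E; rewrite a'0 b0 mul0r addr0.
Qed.

End Kernel.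

(** * The drop in dimension caused by further double points *)

Section Corank.
Variable K : numFieldType.

Lemma rank_slab_jac_general r d a (W : 'M[K]_(a, slab_dim r d.+1)) m :
  (m <= 2)%N -> (m <= \rank W)%N ->
  exists p : 'rV[K]_r.+1, (m <= \rank (W *m slab_jac d.+1 p))%N.
Proof.
move=> m2 mW; case: m m2 mW => [|[|[|//]]] _ mW; first by exists 0.
  have /rowV0Pn[c /submxP[u cE] c0] : W != 0 by rewrite -mxrank_eq0 -lt0n.
  have [p /slab_jac_rank1 pJ] := slab_mono_neq0 c0.
  exists p; rewrite lt0n mxrank_eq0; apply: contra_neq pJ => WJ.
  by rewrite cE -mulmxA WJ mulmx0.
have [L [N LN]] := mxrank_witness mW.
pose c i := row i L *m W.
have [|p pP] := @slab_jac_rank2 K r d (c 0) (c 1).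
  move=> x y xy0.
  have : (x *: delta_mx 0 0 + y *: delta_mx 0 1) *m (L *m W *m N) = 0 :> 'rV_2.
    by rewrite mulmxA mulmxDl -!scalemxAl -!rowE !row_mul xy0 mul0mx.
  rewrite LN mulmx1 => /rowP e; move: (e 0) (e 1).
  by rewrite !mxE /= !mulr1 !mulr0 addr0 add0r.
exists p; suff /eqP r2 : row_free (L *m (W *m slab_jac d.+1 p)).
  by apply: leq_trans (mxrankM_maxr L _); rewrite r2.
rewrite -kermx_eq0.
apply/rowV0P => v; rewrite sub_kermx => /eqP.
have -> : v = v 0 0 *: delta_mx 0 0 + v 0 1 *: delta_mx 0 1.
  apply/rowP=> j; rewrite !mxE /=.
  have [->|->] : j = 0 \/ j = 1.
    by case: j => [[|[|//]] ?]; [left | right]; apply: val_inj.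
    by rewrite eqxx !mulr1 !mulr0 addr0.
  by rewrite eqxx !mulr1 !mulr0 add0r.
rewrite !mulmxA mulmxDl -!scalemxAl => e.
rewrite mulmxDl -!scalemxAl -!rowE in e.
by have [-> ->] := pP _ _ e; rewrite !scale0r addr0.
Qed.

Lemma rank_slab_jacs_add r d q (P : 'M[K]_(q, r.+1)) (p : 'rV[K]_r.+1) :
  (\rank (slab_jacs d P) + \rank (kermx (slab_jacs d P) *m slab_jac d p)
   <= \rank (slab_jacs d (col_mx p P : 'M_(1 + q, r.+1))))%N.
Proof.
pose W := kermx (slab_jacs d P); pose P' : 'M_(1 + q, r.+1) := col_mx p P.
have : (kermx (slab_jacs d P') <= W :&: kermx (slab_jac d p))%MS.
  apply/row_subP => i; have := row_sub i (kermx (slab_jacs d P')).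
  move/sub_ker_slab_jacs => c0; rewrite sub_capmx; apply/andP; split.
    by apply/sub_ker_slab_jacs => j; have := c0 (rshift 1 j); rewrite row_colD.
  by rewrite sub_kermx; have := c0 (lshift q 0); rewrite row_colU row_id => ->.
move/mxrankS; rewrite mxrank_ker => le1.
have := mxrank_mul_ker W (slab_jac d p); rewrite mxrank_ker -/W -/P'.
have := rank_leq_row (slab_jacs d P); have := rank_leq_row (slab_jacs d P'); lia.
Qed.

(** At a general point the gradient map has rank at least 2 on the surviving forms, or is injective
    if their dimension is less than 2. *)
Lemma corank_le_succ r d q z : corank_le K r d.+1 q z.+2 -> corank_le K r d.+1 q.+1 z.
Proof.
move=> [P Pz]; have [||p pP] := @rank_slab_jac_general r d _ (kermx (slab_jacs d.+1 P))
  (minn 2 (\rank (kermx (slab_jacs d.+1 P)))); rewrite ?geq_minl ?geq_minr //.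
exists (col_mx p P : 'M_(1 + q, r.+1)).
apply: leq_trans (leq_add (rank_slab_jacs_add d.+1 P p) (leqnn z)).
apply: leq_trans (leq_add (leq_add (leqnn _) pP) (leqnn z)).
by rewrite mxrank_ker; lia.
Qed.

Lemma corank_le_add r d q z : corank_le K r d q z -> corank_le K r d q.+1 z.
Proof.
move=> [P Pz]; exists (col_mx 0 P : 'M_(1 + q, r.+1)).
by apply: leq_trans (leq_add (rank_slab_jacs_add d P 0) (leqnn z)); lia.
Qed.

Lemma corank_le_iter r d q z j : corank_le K r d.+1 q (z + j.*2) -> corank_le K r d.+1 (q + j) z.
Proof.
elim: j q => [|j IHj] q; first by rewrite !addn0.
by rewrite doubleS !addnS => /corank_le_succ; rewrite -addSn; apply: IHj.
Qed.

Lemma corank_le_leq r d q q' z : (q <= q')%N -> corank_le K r d q z -> corank_le K r d q' z.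
Proof. by move/subnK <-; elim: (q' - q)%N => // j IH /IH /corank_le_add. Qed.

Lemma row_1id n (p : 'rV[K]_n) i : row i p = p.
Proof. by apply/rowP=> j; rewrite mxE ord1. Qed.

(** Linear forms have arbitrary gradients; multiplication by the newest variable, nonzero at [p],
    raises the degree. *)
Lemma slab_jac_surj1 r d (p : 'rV[K]_r.+2) (w : 'rV[K]_r.+2) : p 0 0 != 0 ->
  exists c : 'rV_(slab_dim r.+1 d.+1), c *m slab_jac d.+1 p = w.
Proof.
move=> p0.
have lin r' : forall q v : 'rV[K]_r'.+1, exists c : 'rV_(slab_dim r' 1), c *m slab_jac 1 q = v.
  elim: r' => [|r' IH] q v.
    exists (const_mx (v 0 0)); apply/rowP=> j; rewrite !ord1 mxE big_ord1 !mxE mulr1.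
    by [].
  have [c0 c0P] := IH (row_tail q) (row_tail v).
  exists (rcat c0 (const_mx (v 0 0) : 'rV_(slab_dim r'.+1 0))).
  rewrite rcat_slab_jac c0P slab_jac0 mulmx0 scaler0 addr0 [RHS]row_tail_split.
  rewrite mxE big_ord1 !mxE mulr1.
  apply/rowP=> l; rewrite !mxE; case: splitP => l' ll'; rewrite !mxE ?ord1.
    have -> : l = 0 by apply: val_inj; rewrite /= ll' ord1.
    by rewrite eqxx mulr1 add0r.
  suff -> : (l == 0) = false by rewrite andbF mulr0 addr0.
  by apply/negbTE; rewrite -val_eqE /= ll'.
elim: d w => [|d IHd] w; first exact: lin.
have [v vP] := shift_jac_solve d w p0.
have [c cE] := IHd v; exists (rcat 0 c).
by rewrite rcat_slab_jac mul0mx row_mx0 add0r cE vP.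
Qed.

Lemma indep_points1 r d : indep_points K r.+1 d.+1 1.
Proof.
exists (const_mx 1) => W.
have [|c cE] := @slab_jac_surj1 r d (const_mx 1) (row 0 W); first by rewrite mxE oner_eq0.
by exists c => i; rewrite row_1id ord1.
Qed.

Lemma slab_mono_at0 r d : slab_mono d.+1 (0 : 'rV[K]_r.+1) = 0.
Proof.
elim: r d => [|r IHr] d.
  by case: d => [|d]; apply/matrixP=> i j; rewrite !mxE.
rewrite slab_monoS mxE scale0r (_ : row_tail 0 = 0) ?IHr ?col_mx0 //.
by apply/rowP=> j; rewrite !mxE.
Qed.

Lemma slab_jac_at0 r d : slab_jac d.+2 (0 : 'rV[K]_r.+1) = 0.
Proof.
elim: r d => [|r IHr] d; first by apply/matrixP=> -[].
rewrite slab_jacS mxE scale0r slab_mono_at0 mul0mx addr0 (_ : row_tail 0 = 0).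
  by rewrite IHr row_mx0 col_mx0.
by apply/rowP=> j; rewrite !mxE.
Qed.

(** A quadric singular at the coordinate point of the newest variable is a cone free of that
    variable; the other points are put on the opposite hyperplane. *)
Lemma corank_quadrics r q z : corank_le K r 2 q z -> corank_le K r.+1 2 q.+1 z.
Proof.
move=> [Y YP].
pose e : 'rV[K]_r.+2 := row_mx 1%:M (0 : 'rV_r.+1).
have e0 : e 0 0 = 1 by rewrite /e head_row mxE eqxx.
have et : row_tail e = 0 by rewrite /e row_tail_row.
pose P : 'M_(1 + q, r.+2) := col_mx e (row_mx (0 : 'cV_q) Y).
pose pr : 'M[K]_(slab_dim r 2, slab_dim r.+1 2) := @row_mx _ _ (slab_dim r 2) (slab_dim r.+1 1) 1%:M 0.
have prE c : c *m pr = rcat c 0.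
  by rewrite /pr (@mul_mx_row _ _ _ (slab_dim r 2)) mulmx1 mulmx0.
exists P; suff /mxrankS : (kermx (slab_jacs 2 P) <= kermx (slab_jacs 2 Y) *m pr)%MS.
  move/leq_trans => /(_ _ (mxrankM_maxl _ _)); rewrite !mxrank_ker => le1.
  by rewrite -leq_subLR; apply: leq_trans le1 _; rewrite leq_subLR.
apply/row_subP => i; have := row_sub i (kermx (slab_jacs 2 P)).
move: (row i _) => c /sub_ker_slab_jacs cP.
have [c0 [c1 cE]] := rcatP c; rewrite cE in cP *.
have := cP (lshift q 0); rewrite row_colU row_1id rcat_slab_jac et slab_jac_at0 mulmx0 row_mx0 add0r.
case/shift_jac_ker; first by rewrite e0 oner_eq0.
move=> c1J _.
(* A linear form has the same gradient everywhere, so by Euler's identity it is zero once its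
   gradient at [e] is. *)
have c10 : c1 = 0.
  apply/eqP; apply: contraT => /slab_mono_neq0[p]; rewrite -[slab_mono 1 p]scale1r -[1]/(1%:R) -slab_euler.
  have -> : slab_jac 1 p = slab_jac 1 e.
    have const r' : forall p q : 'rV[K]_r'.+1, slab_jac 1 p = slab_jac 1 q.
      by elim: r' => [//|r' IH] u v; rewrite !slab_jacS !slab_jac0 !scaler0 (IH (row_tail u) (row_tail v)).
    exact: const.
  by rewrite mulmxA c1J mul0mx mxE eqxx.
rewrite c10 -prE submxMr //; apply/sub_ker_slab_jacs => j.
have := cP (rshift 1 j); rewrite row_colD c10.
have -> : row j (row_mx (0 : 'cV_q) Y : 'M_(q, r.+2)) = row_mx (0 : 'M_1) (row j Y).
  by rewrite (@row_row_mx _ _ 1 r.+1) row0.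
rewrite rcat_slab_jac head_row0 scale0r addr0 mul0mx mxE scale0r addr0 row_tail_row.
rewrite -[RHS](@row_mx0 _ 1 1 r.+1) => /(congr1 (@row_tail K r)).
by rewrite !row_tail_row.
Qed.

End Corank.

(** * Double points of cubics *)

(* A cubic is a symmetric trilinear form [T], with gradient [3 T(p, p, .)] at [p]. *)
Section Tensors.
Variable K : numFieldType.

Definition sym3 (I : Type) (T : I -> I -> I -> K) :=
  forall j m l, T j m l = T m j l /\ T j m l = T j l m.

Definition tensor_eval (I : finType) (T : I -> I -> I -> K) (p : I -> K) l :=
  \sum_j \sum_m p j * p m * T j m l.

Definition tensor_indep (I A : finType) (P : A -> I -> K) :=
  forall W : A -> I -> K, exists T, sym3 T /\ forall a l, tensor_eval T (P a) l = W a l.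

Lemma tensor_indep_transport (I I' A A' : finType) (P : A -> I -> K) (f : I' -> I) (h : A' -> A) :
  bijective f -> injective h -> tensor_indep P -> tensor_indep (fun a i => P (h a) (f i)).
Proof.
move=> [f' fK f'K] hI cP W.
have [T [sT TP]] := cP (fun a i => if [pick a' | h a' == a] is Some a' then W a' (f' i) else 0).
exists (fun j m l => T (f j) (f m) (f l)); split=> [j m l|a l]; first exact: sT.
transitivity (tensor_eval T (P (h a)) (f l)).
  rewrite /tensor_eval (reindex f) /=; last by exists f' => x _.
  by apply: eq_bigr => j _; rewrite [RHS](reindex f) //=; exists f' => x _.
rewrite TP; case: pickP => [a' /eqP/hI ->|/(_ a)]; last by rewrite eqxx.
by rewrite fK.
Qed.

Lemma line_open_tensor_indep n t :
  line_open (fun P : 'M[K]_(t, n) => tensor_indep (fun a j => P a j)).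
Proof.
move=> A B cA.
(* Tensors whose gradients at [A] form the standard basis: the matrix [F] of their gradients is the
   identity at [A], hence of full rank almost everywhere on the line. *)
have [T TP] : exists T : 'I_(t * n) -> 'I_n -> 'I_n -> 'I_n -> K, forall x,
    sym3 (T x) /\ forall a l, tensor_eval (T x) (fun j => A a j) l = (mxvec_index a l == x)%:R.
  apply: (@fin_all_exists _ (fun=> 'I_n -> 'I_n -> 'I_n -> K) (fun x T => sym3 T /\
    forall a l, tensor_eval T (fun j => A a j) l = (mxvec_index a l == x)%:R)) => x.
  exact: (cA (fun a l => (mxvec_index a l == x)%:R)).
pose F (R : comNzRingType) (c : K -> R) (P : 'M[R]_(t, n)) : 'M[R]_(t * n) :=
  \matrix_(x, y) mxvec (\matrix_(a, l) \sum_j \sum_m P a j * P a m * c (T x j m l)) 0 y.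
have Fnat u X : map_mx (horner_eval u) (F {poly K} polyC X) =
    F K id (map_mx (horner_eval u) X).
  apply/matrixP=> x y; case/mxvec_indexP: y => a l; rewrite !mxE !mxvecE !mxE.
  rewrite /horner_eval !horner_sum; apply: eq_bigr => j _.
  rewrite horner_sum; apply: eq_bigr => m _.
  by rewrite !mxE !hornerM hornerC.
have [|g g0 gP] := @line_open_rank K t n _ _ _ _ (t * n) Fnat A B.
  rewrite (_ : F K id A = 1%:M) ?mxrank1 //.
  apply/matrixP=> x y; case/mxvec_indexP: y => a l; rewrite !mxE !mxvecE !mxE.
  by have [_ /(_ a l)] := TP x; rewrite /tensor_eval eq_sym => ->.
exists g => // u /gP /row_full_surj FP W.
have [c cP] := FP (mxvec (\matrix_(a, l) W a l)).
exists (fun j m l => \sum_x c 0 x * T x j m l); split=> [j m l|a l].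
  by split; apply: eq_bigr => x _; have [/(_ j m l)[e1 e2] _] := TP x; congr (_ * _).
transitivity ((mxvec (\matrix_(a, l) W a l)) 0 (mxvec_index a l)); last first.
  by rewrite mxvecE mxE.
rewrite -cP mxE /tensor_eval.
transitivity (\sum_j \sum_m \sum_x c 0 x * ((A + u *: (B - A)) a j * (A + u *: (B - A)) a m * T x j m l)).
  apply: eq_bigr => j _; apply: eq_bigr => m _; rewrite mulr_sumr.
  by apply: eq_bigr => x _; rewrite mulrCA.
transitivity (\sum_x \sum_j \sum_m c 0 x * ((A + u *: (B - A)) a j * (A + u *: (B - A)) a m * T x j m l)).
  by rewrite [RHS]exchange_big; apply: eq_bigr => j _; rewrite exchange_big.
apply: eq_bigr => x _; rewrite mxE mxvecE mxE mulr_sumr.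
by apply: eq_bigr => j _; rewrite mulr_sumr.
Qed.

(* A quadric is given by one coefficient for each pair [{j, m}], with [[set j; j]] being
   the singleton; off-diagonal coefficients count twice. *)
Definition quad_eval (I : finType) (B : {set I} -> K) (p : I -> K) :=
  \sum_j \sum_m p j * p m * B [set j; m].

Definition quad_indep (I A : finType) (E : {set {set I}}) (P : A -> I -> K) :=
  forall w : A -> K, exists B : {set I} -> K,
    (forall e, e \notin E -> B e = 0) /\ forall a, quad_eval B (P a) = w a.

Definition qmons n (E : {set {set 'I_n}}) (R : comNzRingType) (p : 'rV[R]_n) : 'cV[R]_#|E| :=
  \col_i \sum_j \sum_m p 0 j * p 0 m * (enum_val i == [set j; m])%:R.

Definition qmat n t (E : {set {set 'I_n}}) (R : comNzRingType) (P : 'M[R]_(t, n)) :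
  'M[R]_(#|E|, t) := \matrix_(i, a) qmons E (row a P) i 0.

Lemma qmonsE n (E : {set {set 'I_n}}) (c : 'rV[K]_#|E|) (p : 'rV[K]_n) :
  let B e := \sum_i c 0 i * (enum_val i == e)%:R in
  (c *m qmons E p) 0 0 = quad_eval B (fun j => p 0 j).
Proof.
rewrite /= mxE /quad_eval.
transitivity (\sum_i \sum_j \sum_m c 0 i * (p 0 j * p 0 m * (enum_val i == [set j; m])%:R)).
  by apply: eq_bigr => i _; rewrite mxE mulr_sumr; apply: eq_bigr => j _; rewrite mulr_sumr.
rewrite exchange_big; apply: eq_bigr => j _; rewrite exchange_big; apply: eq_bigr => m _.
by rewrite mulr_sumr; apply: eq_bigr => i _; rewrite mulrCA.
Qed.

Lemma quad_indep_rank n t (E : {set {set 'I_n}}) (P : 'M[K]_(t, n)) :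
  (t <= \rank (qmat E P))%N ->
  quad_indep E (fun a j => P a j).
Proof.
move=> /row_full_surj Ps w; have [c cP] := Ps (\row_a w a).
exists (fun e => \sum_i c 0 i * (enum_val i == e)%:R); split=> [e eE|a].
  rewrite big1 // => i _; case: eqP => [ie|]; last by rewrite mulr0.
  by rewrite -ie enum_valP in eE.
have /rowP/(_ a) := cP; rewrite [RHS]mxE => <-.
transitivity ((c *m qmons E (row a P)) 0 0); last first.
  by rewrite !mxE; apply: eq_bigr => i _; rewrite !mxE.
rewrite qmonsE /quad_eval; apply: eq_bigr => j _; apply: eq_bigr => m _.
by rewrite !mxE.
Qed.

Lemma line_open_quad n t (E : {set {set 'I_n}}) :
  line_open (fun P : 'M[K]_(t, n) =>
    t <= \rank (qmat E P))%N.
Proof.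
apply: (line_open_rank (FP := fun P => qmat E P)) => u X.
apply/matrixP=> i a; rewrite !mxE /horner_eval horner_sum; apply: eq_bigr => j _.
rewrite horner_sum; apply: eq_bigr => m _.
by rewrite !mxE !hornerM -polyC_natr hornerC.
Qed.

(** A nonzero quadric is nonzero at some coordinate point or at a sum of two of them, so the points
    can be picked one at a time. *)
Lemma quad_points n t (E : {set {set 'I_n}}) :
  (forall e, e \in E -> exists j m, e = [set j; m]) -> (t <= #|E|)%N ->
  exists P : 'M[K]_(t, n),
    (t <= \rank (qmat E P))%N.
Proof.
move=> Epair tE.
have [||Y YP] := @eval_points_gen K n #|E| (fun p => qmons E p) _ 1%:M t; last 1 first.
- by exists Y; rewrite mul1mx in YP.
- move=> c _ c0; pose B e := \sum_i c 0 i * (enum_val i == e)%:R.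
  have B0 : exists j m, B [set j; m] != 0.
    have [i ci] := rV0Pn _ c0; have [j [m e]] := Epair _ (enum_valP i).
    exists j, m; rewrite /B -e (bigD1 i) //= eqxx mulr1 big1 ?addr0 // => k ki.
    by rewrite (inj_eq enum_val_inj) (negPf ki) mulr0.
  have dsum (x : 'I_n) (F : 'I_n -> K) : \sum_j (j == x)%:R * F j = F x.
    by rewrite (bigD1 x) //= eqxx mul1r big1 ?addr0 // => j /negPf ->; rewrite mul0r.
  have qB p : (c *m qmons E p) 0 0 = \sum_j p 0 j * \sum_m p 0 m * B [set j; m].
    rewrite qmonsE /quad_eval; apply: eq_bigr => j _; rewrite mulr_sumr.
    by apply: eq_bigr => m _; rewrite mulrA.
  have qdelta x : (c *m qmons E (\row_j (j == x)%:R)) 0 0 = B [set x; x].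
    rewrite qB -[RHS](dsum x (fun j => B [set j; x])); apply: eq_bigr => j _.
    rewrite mxE; congr (_ * _).
    by rewrite -[RHS](dsum x (fun m => B [set j; m])); apply: eq_bigr => m _; rewrite mxE.
  have [j [m Bjm]] := B0.
  have [jj0|] := eqVneq (B [set j; j]) 0; last first.
    by move=> Bj; exists (\row_k (k == j)%:R); rewrite qdelta.
  have [mm0|] := eqVneq (B [set m; m]) 0; last first.
    by move=> Bm; exists (\row_k (k == m)%:R); rewrite qdelta.
  have dsum2 (F : 'I_n -> K) : \sum_k ((k == j)%:R + (k == m)%:R) * F k = F j + F m.
    by rewrite -(dsum j) -(dsum m) -big_split; apply: eq_bigr => k _; rewrite mulrDl.
  exists (\row_k ((k == j)%:R + (k == m)%:R)).
  have -> : (c *m qmons E (\row_k ((k == j)%:R + (k == m)%:R))) 0 0 = 2 * B [set j; m].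
    rewrite qB; transitivity (\sum_k ((k == j)%:R + (k == m)%:R) * (B [set k; j] + B [set k; m])).
      apply: eq_bigr => k _; rewrite mxE -(dsum2 (fun l => B [set k; l])); congr (_ * _).
      by apply: eq_bigr => l _; rewrite mxE.
    by rewrite dsum2 jj0 mm0 add0r addr0 setUC; ring.
  by rewrite mulf_neq0 ?pnatr_eq0.
- by rewrite mxrank1.
Qed.

End Tensors.

(** * Adding three variables to the cubics *)

Section CubicStep.
Variable K : numFieldType.

Lemma sum_delta (I : finType) (x : I) (F : I -> K) : \sum_j (j == x)%:R * F j = F x.
Proof.
by rewrite (bigD1 x) //= eqxx mul1r big1 ?addr0 // => j /negPf ->; rewrite mul0r.
Qed.

Lemma tensor_eval_delta (I : finType) (T : I -> I -> I -> K) x l :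
  tensor_eval T (fun i => (i == x)%:R) l = T x x l.
Proof.
rewrite /tensor_eval -[RHS](sum_delta x (fun j => T j x l)); apply: eq_bigr => j _.
rewrite -[T j x l](sum_delta x (fun m => T j m l)) mulr_sumr.
by apply: eq_bigr => m _; rewrite mulrA.
Qed.

Lemma tensor_eval_delta3 (I : finType) (T : I -> I -> I -> K) (s : K) x y z l : sym3 T ->
  tensor_eval T (fun i => (i == x)%:R + (i == y)%:R + s * (i == z)%:R) l =
  T x x l + T y y l + s ^+ 2 * T z z l + 2 * T x y l + 2 * s * T x z l + 2 * s * T y z l.
Proof.
move=> sT.
have sum3 (F : I -> K) :
    \sum_i ((i == x)%:R + (i == y)%:R + s * (i == z)%:R) * F i = F x + F y + s * F z.
  rewrite -(sum_delta x F) -(sum_delta y F) -(sum_delta z F) mulr_sumr -!big_split.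
  by apply: eq_bigr => i _ /=; ring.
rewrite /tensor_eval.
transitivity (\sum_j ((j == x)%:R + (j == y)%:R + s * (j == z)%:R) *
    (T j x l + T j y l + s * T j z l)).
  apply: eq_bigr => j _; rewrite -(sum3 (fun m => T j m l)) mulr_sumr.
  by apply: eq_bigr => m _; rewrite mulrA.
rewrite sum3; have [e1 _] := sT y x l; have [e2 _] := sT z x l; have [e3 _] := sT z y l.
by rewrite e1 e2 e3; ring.
Qed.

(** The entries with a repeated index belong to distinct monomials x_i^2 x_l, so they can be
    prescribed freely; the others are set to 0. *)
Lemma tensor_coord (I : finType) (W : I -> I -> K) :
  exists T, sym3 T /\ forall i l, T i i l = W i l.
Proof.
pose Y (i k l : I) : K := if i == k then W i l else if k == l then W k i
  else if i == l then W i k else 0.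
exists Y; split=> [i k l|i l]; last by rewrite /Y eqxx.
rewrite /Y (eq_sym k i) (eq_sym l k).
have [->|ik] := eqVneq i k.
  by rewrite ?eqxx; split=> //; case: eqVneq => [->|].
have [kl|kl] := eqVneq k l; last by split.
by rewrite -kl (negPf ik); split.
Qed.

Section Step.
Variables (n t m1 m2 : nat) (P : 'I_t -> 'I_n -> K).
Let m := (m1 + m2)%N.
Hypothesis lemn : (m <= n)%N.

Let inJ (j : 'I_n) := (j < m)%N.
Let J := [set j | inJ j].
(** The added point for [j] in [J] is e_j + y_{g j} + s_j y_2. Two such points of one group put two
    conditions on the same two coefficients; the distinct slopes [s] make these independent. *)
Let g (j : 'I_n) : 'I_3 := if (j < m1)%N then 0 else 1.
Let s (j : 'I_n) : K := j.+1%:R.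
Let J_ (i : 'I_3) := [set j | inJ j && (g j == i)].

Let I := ('I_n + 'I_3)%type.
Definition addpts (a : 'I_t + 'I_m + 'I_3) (x : I) : K :=
  match a with
  | inl (inl a) => if x is inl j then P a j else 0
  | inl (inr k) => let j := widen_ord lemn k in
      (x == inl j)%:R + (x == inr (g j))%:R + s j * (x == inr 2)%:R
  | inr i => (x == inr i)%:R
  end.

(* In a cubic [C(x) + sum_i y_i A_i(x) + ...] singular at the points [addpts], the
   coefficients of [A_0], [A_1], [A_2] with index in [E 0], [E 1], [E2] remain free.
   [A_2] has to be fixed first: the other two are solved for in terms of it. *)
Let singles := [set [set x] | x in ~: J].
Let E i : {set {set 'I_n}} :=
  [set A in powerset (~: J_ i) | #|A| == 2] :|: singles.
Let E2 : {set {set 'I_n}} :=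
  ([set A in powerset setT | #|A| == 2] :\: powerset J) :|: singles.

Hypothesis cubP : tensor_indep P.
Hypothesis quad0 : quad_indep (E 0) P.
Hypothesis quad1 : quad_indep (E 1) P.
Hypothesis quad2 : quad_indep E2 P.

Let s_inj j l : s j = s l -> j = l.
Proof. by move/eqP; rewrite eqr_nat eqSS => /eqP/ord_inj. Qed.

Let s_neq0 j : s j != 0.
Proof. by rewrite pnatr_eq0. Qed.

Let ord3 (i : 'I_3) : [\/ i = 0, i = 1 | i = 2].
Proof.
case: i => [[|[|[|//]]] lt3]; [constructor 1|constructor 2|constructor 3]; exact: val_inj.
Qed.

Let g01 j : g j = 0 \/ g j = 1.
Proof. by rewrite /g; case: ifP; [left|right]. Qed.

Let g_neq2 j : (g j == 2) = false.
Proof. by have [->|->] := g01 j. Qed.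

Lemma cubic_step : tensor_indep addpts.
Proof.
move=> W.
(* The cubic is assembled from parts of degree 0, 1, 2, 3 in the new variables: [C], [A], [L], [Y].
   [C] serves the old points in the old directions; [Y] and the diagonal of [L] serve the new
   coordinate points. *)
have [C [sC CP]] := cubP (fun a l => W (inl (inl a)) (inl l)).
have sC1 j k l : C j k l = C k j l by have [] := sC j k l.
have sC2 j k l : C j k l = C j l k by have [] := sC j k l.
pose WJ (j : 'I_n) (x : I) : K := if insub (j : nat) is Some k then W (inl (inr k)) x else 0.
have WJE k x : WJ (widen_ord lemn k) x = W (inl (inr k)) x.
  rewrite /WJ insubT //= => lt; congr (W (inl (inr _)) x); exact: val_inj.
pose Wf (i : 'I_3) x := W (inr i) x.
have [Y [sY Yii]] := tensor_coord (fun i k => Wf i (inr k)).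
pose Yyy j i := Y (g j) (g j) i + 2 * s j * Y (g j) 2 i + s j ^+ 2 * Y 2 2 i.
pose L0 l (i : 'I_3) := Wf i (inl l).
pose cst j := 2 * ((WJ j (inr (g j)) - 2 * L0 j (g j) - Yyy j (g j))
   + s j * (WJ j (inr 2) - 2 * s j * L0 j 2 - Yyy j 2))
   + L0 j (g j) + s j ^+ 2 * L0 j 2 + C j j j.
(* The entry of [L] at x_j, y_{g j}, y_2 enters the x_j-derivative at the point of [j] with factor 2
   s_j directly and -8 s_j through [D]; [cst] is the rest. *)
pose lam j := (cst j - WJ j (inl j)) / (6 * s j).
pose L l (i k : 'I_3) : K := if i == k then L0 l i else
  if inJ l && (((i == g l) && (k == 2)) || ((k == g l) && (i == 2))) then lam l else 0.
have sL l i k : L l i k = L l k i.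
  rewrite /L [k == i]eq_sym orbC; case: eqVneq => [->//|_].
  by [].
pose Lyy j l := L l (g j) (g j) + 2 * s j * L l (g j) 2 + s j ^+ 2 * L l 2 2.
(* The y_i-derivative at the point of [j] imposes [D j i] as diagonal entry of A_i. For l different
   from j, the x_l-derivative imposes A_{g j} + s_j A_2 = [R j l] at the entry (j, l). *)
pose D j i := WJ j (inr i) - 2 * (L j (g j) i + s j * L j 2 i) - Yyy j i.
pose R j l := (WJ j (inl l) - C j j l - Lyy j l) / 2.
pose same j l := [&& inJ j, inJ l & g j == g l].
(* For [j] and [l] in one group there are two equations for the same entries of A_{g j} and A_2;
   this is their solution for A_2. *)
pose N2 j l : K := if j == l then (if inJ j then D j 2 else 0)
  else if same j l then (R j l - R l j) / (s j - s l) else 0.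
have sN2 j l : N2 j l = N2 l j.
  rewrite /N2 eq_sym; case: eqVneq => [->//|jl].
  have -> : same l j = same j l by rewrite /same (eq_sym (g l)) andbCA.
  case: ifP => // _; rewrite -[s l - s j]opprB invrN mulrN -mulNr; congr (_ / _).
  by rewrite opprB.
have [B2 [B2E B2P]] := quad2 (fun a => W (inl (inl a)) (inr 2)
   - \sum_j \sum_k P a j * P a k * N2 j k).
pose A2 j l := N2 j l + B2 [set j; l].
have sA2 j l : A2 j l = A2 l j by rewrite /A2 sN2 setUC.
(* Once A_2 is known, each equation gives an entry of A_0 or A_1; within one group the two
   expressions agree by the choice of [N2]. *)
pose N i j l : K := if j == l then (if inJ j then D j i else 0)
  else if inJ j && (g j == i) then R j l - s j * A2 j l
  else if inJ l && (g l == i) then R l j - s l * A2 j l else 0.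
have B2J j l : inJ j -> inJ l -> B2 [set j; l] = 0.
  move=> jJ lJ; apply: B2E; rewrite !inE negb_or; apply/andP; split.
    rewrite negb_and negbK; apply/orP; left; apply/subsetP => x.
    by rewrite !inE => /orP[] /eqP ->.
  apply/imsetP => -[x]; rewrite !inE => xJ /setP/(_ x); rewrite !inE eqxx.
  by move=> /orP[] /eqP ex; rewrite ex ?jJ ?lJ in xJ.
have NR i j l : j != l -> inJ j -> g j = i -> N i j l + s j * A2 j l = R j l.
  by move=> /negPf jl jJ gj; rewrite /N jl jJ gj eqxx /= subrK.
have sN i j l : N i j l = N i l j.
  rewrite /N (eq_sym l j) [A2 l j]sA2; case: eqVneq => [->//|jl].
  case: ifP => [/andP[jJ /eqP gj]|_]; case: ifP => [/andP[lJ /eqP gl]|_] //.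
  have A2E : A2 j l = (R j l - R l j) / (s j - s l).
    by rewrite /A2 /N2 (negPf jl) /same jJ lJ gj gl eqxx B2J // addr0.
  have sjl : s j - s l != 0 by rewrite subr_eq0; apply: contra_neq jl => /s_inj.
  rewrite A2E; move: (R j l) (R l j) (s j) (s l) sjl => a b c e ce.
  by field.
have [B0 [B0E B0P]] := quad0 (fun a => W (inl (inl a)) (inr 0)
   - \sum_j \sum_k P a j * P a k * N 0 j k).
have [B1 [B1E B1P]] := quad1 (fun a => W (inl (inl a)) (inr 1)
   - \sum_j \sum_k P a j * P a k * N 1 j k).
pose A j l (i : 'I_3) := if i == 0 then N 0 j l + B0 [set j; l]
  else if i == 1 then N 1 j l + B1 [set j; l] else A2 j l.
have sA j l i : A j l i = A l j i.
  by rewrite /A sN (sN 1) [A2 j l]sA2 [_ |: _]setUC.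
have diagJ j i : inJ j -> A j j i = D j i.
  move=> jJ; rewrite /A /A2 /N /N2 !eqxx jJ.
  have B0J : B0 [set j; j] = 0.
    apply: B0E; rewrite !inE negb_or setUid cards1 andbF /=.
    apply/imsetP => -[x]; rewrite !inE => xJ /setP/(_ j).
    by rewrite !inE eqxx => /esym/eqP jx; rewrite -jx jJ in xJ.
  have B1J : B1 [set j; j] = 0.
    apply: B1E; rewrite !inE negb_or setUid cards1 andbF /=.
    apply/imsetP => -[x]; rewrite !inE => xJ /setP/(_ j).
    by rewrite !inE eqxx => /esym/eqP jx; rewrite -jx jJ in xJ.
  by have [->|->|->] := ord3 i; rewrite /= ?B0J ?B1J ?B2J ?addr0.
have offJ j l : j != l -> inJ j -> A j l (g j) + s j * A j l 2 = R j l.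
  move=> jl jJ; rewrite -(NR (g j) j l jl jJ erefl).
  have notin i : g j = i -> [set j; l] \notin E i.
    move=> gj; rewrite !inE negb_or; apply/andP; split.
      apply/negP => /andP[/subsetP/(_ j)]; rewrite !inE eqxx jJ gj eqxx => /(_ isT).
      by [].
    by apply/imsetP => -[x _ /(congr1 (fun A : {set _} => #|A|))]; rewrite cards1 cards2 jl.
  rewrite /A; have [gj|gj] := g01 j; rewrite gj /=.
    by rewrite B0E ?addr0 //; apply: notin.
  by rewrite B1E ?addr0 //; apply: notin.
pose T (x y z : I) : K := match x, y, z with
  | inl j, inl k, inl l => C j k l
  | inl j, inl k, inr i | inl j, inr i, inl k | inr i, inl j, inl k => A j k i
  | inl l, inr i, inr k | inr i, inl l, inr k | inr i, inr k, inl l => L l i k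
  | inr i, inr k, inr l => Y i k l
  end.
have sT : sym3 T.
  move=> [x|x] [y|y] [z|z] /=; split => //; try exact: sC1; try exact: sC2;
    try exact: sA; try exact: sL; try exact: (sY _ _ _).1; try exact: (sY _ _ _).2.
exists T; split=> // a x.
case: a => [[a|k]|i]; last by rewrite tensor_eval_delta; case: x => [l|i'] /=; rewrite ?Yii // /L eqxx.
  have tevE : tensor_eval T (addpts (inl (inl a))) x =
      \sum_j \sum_k P a j * P a k * T (inl j) (inl k) x.
    rewrite /tensor_eval big_sumType /= [X in _ + X]big1 ?addr0.
      apply: eq_bigr => j _; rewrite big_sumType /= [X in _ + X]big1 ?addr0 //.
      by move=> i _; rewrite mulr0 mul0r.
    by move=> i _; rewrite big1 // => y _; rewrite !mul0r.
  rewrite tevE; case: x {tevE} => [l|i]; first exact: CP.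
  have split2 (N' : 'I_n -> 'I_n -> K) (B' : {set 'I_n} -> K) :
      \sum_j \sum_k P a j * P a k * (N' j k + B' [set j; k]) =
      \sum_j \sum_k P a j * P a k * N' j k + quad_eval B' (P a).
    rewrite /quad_eval -big_split; apply: eq_bigr => j _; rewrite -big_split.
    by apply: eq_bigr => k _; rewrite /= mulrDr.
  have [->|->|->] := ord3 i; rewrite /= /A /=.
  - by rewrite split2 B0P addrC subrK.
  - by rewrite split2 B1P addrC subrK.
  by rewrite split2 B2P addrC subrK.
rewrite tensor_eval_delta3 //; set j := widen_ord lemn k.
have jJ : inJ j by rewrite /inJ /j /= ltn_ord.
have Lgg l : L l (g j) (g j) = L0 l (g j) by rewrite /L eqxx.
have L22 l : L l 2 2 = L0 l 2 by rewrite /L eqxx.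
case: x => [l|i] /=; last first.
  rewrite diagJ // /D WJE /Yyy.
  move: (W _ _) => w; ring.
rewrite (sA j l 2) -/j.
have [<-|jl] := eqVneq j l; last first.
  have := offJ j l jl jJ; rewrite /R /Lyy (sA j l) (sA j l 2) WJE => e.
  transitivity (2 * (A l j (g j) + s j * A l j 2) + C j j l + L l (g j) (g j) +
     2 * s j * L l (g j) 2 + s j ^+ 2 * L l 2 2); first by ring.
  by rewrite e; field.
have Lg2 : L j (g j) 2 = lam j by rewrite /L g_neq2 jJ !eqxx.
have L2g : L j 2 (g j) = lam j by rewrite sL.
rewrite !diagJ // /D Lg2 L2g Lgg L22 -WJE -/j.
have : 6 * s j * lam j = cst j - WJ j (inl j).
  by rewrite /lam mulrC divfK // mulf_neq0 ?s_neq0 // pnatr_eq0.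
rewrite /cst => e.
transitivity (WJ j (inl j) + (2 * ((WJ j (inr (g j)) - 2 * L0 j (g j) - Yyy j (g j))
   + s j * (WJ j (inr 2) - 2 * s j * L0 j 2 - Yyy j 2))
   + L0 j (g j) + s j ^+ 2 * L0 j 2 + C j j j - WJ j (inl j)) - 6 * s j * lam j); last first.
  by rewrite -e addrK.
by move: (lam j) => x; ring.
Qed.

End Step.
End CubicStep.

(** * Counting independent double points of cubics *)

Section CubicCount.
Variable K : numFieldType.

Definition cubic_indep n t := exists P : 'M[K]_(t, n), tensor_indep (fun a j => P a j).

Lemma card_singles (I : finType) (S : {set I}) : #|[set [set x] | x in S]| = #|S|.
Proof. exact: card_imset set1_inj. Qed.

Lemma card_supp (I : finType) (S J : {set I}) :
  #|[set A in powerset S | #|A| == 2] :|: [set [set x] | x in J]| = ('C(#|S|, 2) + #|J|)%N.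
Proof.
rewrite cardsU (_ : _ :&: _ = set0) ?cards0 ?subn0.
  by rewrite card_singles -cards_draws; congr (_ + _)%N; apply: eq_card => A; rewrite !inE.
apply/setP=> A; rewrite !inE; apply/negP => /andP[/andP[_ /eqP A2] /imsetP[x _ Ax]].
by rewrite Ax cards1 in A2.
Qed.

Lemma card_supp2 (I : finType) (J S : {set I}) :
  #|([set A in powerset setT | #|A| == 2] :\: powerset J) :|: [set [set x] | x in S]| =
  ('C(#|I|, 2) - 'C(#|J|, 2) + #|S|)%N.
Proof.
rewrite cardsU (_ : _ :&: [set [set x] | x in S] = set0) ?cards0 ?subn0.
  rewrite card_singles cardsD -cardsT -!cards_draws; congr (_ - _ + _)%N.
    by apply: eq_card => A; rewrite !inE.
  by apply: eq_card => A; rewrite !inE subsetT /= andbC.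
apply/setP=> A; rewrite !inE; apply/negP => /andP[/andP[_ /andP[_ /eqP A2]] /imsetP[x _ Ax]].
by rewrite Ax cards1 in A2.
Qed.

Lemma widen_ord_inj n m (le : (n <= m)%N) : injective (widen_ord le).
Proof. by move=> i j /(congr1 val) /= /ord_inj. Qed.

Lemma card_ltn n m : (m <= n)%N -> #|[set j : 'I_n | (j < m)%N]| = m.
Proof.
move=> le; rewrite -[RHS]card_ord -cardsT -(card_imset _ (@widen_ord_inj _ _ le)).
apply: eq_card => j; rewrite !inE; apply/idP/imsetP => [ltj|[k _ ->] /=].
  by exists (Ordinal ltj) => //; apply: val_inj.
exact: ltn_ord.
Qed.

(** The three right-hand sides count the free coefficients of A_0, A_1, A_2. The four conditions on
    the old points are open along lines, so one choice of points meets them all. *)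
Lemma cubic_indep_extend n t m1 m2 (le : (m1 + m2 <= n)%N) : cubic_indep n t ->
  (t <= 'C(n - m1, 2) + (n - (m1 + m2)))%N ->
  (t <= 'C(n - m2, 2) + (n - (m1 + m2)))%N ->
  (t <= 'C(n, 2) - 'C(m1 + m2, 2) + (n - (m1 + m2)))%N ->
  exists P : 'I_t -> 'I_n -> K, tensor_indep (addpts P le).
Proof.
move=> [P0 cP0] t0 t1 t2.
set J := [set j : 'I_n | (j < m1 + m2)%N].
pose g (j : 'I_n) : 'I_3 := if (j < m1)%N then 0 else 1.
pose J_ (i : 'I_3) := [set j : 'I_n | (j < m1 + m2)%N && (g j == i)].
have cJ : #|~: J| = (n - (m1 + m2))%N by rewrite cardsCs setCK card_ord card_ltn.
have cJ0 : #|~: J_ 0| = (n - m1)%N.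
  rewrite cardsCs setCK card_ord -[in RHS](@card_ltn n m1); last lia.
  congr (_ - _)%N; apply: eq_card => j; rewrite !inE /g; case: (ltnP j m1) => ltj; last by rewrite andbC.
  by rewrite (_ : (j < m1 + m2)%N) //; lia.
have cJ1 : #|~: J_ 1| = (n - m2)%N.
  rewrite cardsCs setCK card_ord.
  have := cardsID [set j : 'I_n | (j < m1)%N] J; rewrite (card_ltn le).
  rewrite (_ : J :&: _ = [set j : 'I_n | (j < m1)%N]); last first.
    by apply/setP=> j; rewrite !inE; lia.
  rewrite card_ltn; last lia.
  rewrite (_ : J :\: _ = J_ 1); first lia.
  by apply/setP=> j; rewrite !inE /g andbC; case: (ltnP j m1).
pose sg := [set [set x] | x in ~: J].
pose E i := [set A in powerset (~: J_ i) | #|A| == 2] :|: sg.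
pose E2 := ([set A in powerset setT | #|A| == 2] :\: powerset J) :|: sg.
have pairs (S : {set {set 'I_n}}) : S \subset [set A : {set 'I_n} | #|A| == 2] ->
    forall e, e \in S :|: sg -> exists j m, e = [set j; m].
  move=> /subsetP S2 e; rewrite inE => /orP[/S2|/imsetP[x _ ->]]; last first.
    by exists x, x; rewrite setUid.
  by rewrite inE => /cards2P[x [y [_ ->]]]; exists x, y.
have pE i : forall e, e \in E i -> exists j m, e = [set j; m].
  by apply: pairs; apply/subsetP => A; rewrite !inE => /andP[].
have pE2 : forall e, e \in E2 -> exists j m, e = [set j; m].
  by apply: pairs; apply/subsetP => A; rewrite !inE => /and3P[].
have [Q0 Q0P] : exists Q : 'M[K]_(t, n), (t <= \rank (qmat (E 0%R) Q))%N.
  by apply: quad_points; [apply: pE|rewrite card_supp cJ0 cJ].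
have [Q1 Q1P] : exists Q : 'M[K]_(t, n), (t <= \rank (qmat (E 1%R) Q))%N.
  by apply: quad_points; [apply: pE|rewrite card_supp cJ1 cJ].
have [Q2 Q2P] : exists Q : 'M[K]_(t, n), (t <= \rank (qmat E2 Q))%N.
  by apply: quad_points; [apply: pE2|rewrite card_supp2 card_ord (card_ltn le) cJ].
have o4 := @line_open_tensor_indep K n t.
have oq S := @line_open_quad K n t S.
have [P1 P1P] := line_open_meet o4 (oq (E 0)) cP0 Q0P.
have [P2 P2P] := line_open_meet (line_open_and o4 (oq (E 0))) (oq (E 1)) P1P Q1P.
have [P3 [[[c3 q0] q1] q2]] :=
  line_open_meet (line_open_and (line_open_and o4 (oq (E 0))) (oq (E 1))) (oq E2) P2P Q2P.
exists (fun a j => P3 a j).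
by apply: cubic_step => //; apply: quad_indep_rank.
Qed.

Lemma tensor_indep_coord (I : finType) : tensor_indep (fun a j : I => (j == a)%:R : K).
Proof.
move=> W; have [T [sT TW]] := tensor_coord W; exists T; split=> // a l.
by rewrite tensor_eval_delta TW.
Qed.

Lemma cubic_indep_fin (I A : finType) (P : A -> I -> K) n t : tensor_indep P ->
  n = #|I| -> (t <= #|A|)%N -> cubic_indep n t.
Proof.
move=> cP -> tA; exists (\matrix_(a, j) P (enum_val (widen_ord tA a)) (enum_val j)).
move=> W; have [||T [sT TP]] := tensor_indep_transport (f := @enum_val I I)
   (h := fun a => enum_val (widen_ord tA a)) _ _ cP W.
- exact: enum_val_bij.
- by move=> a b /enum_val_inj /widen_ord_inj.
exists T; split=> // a l; rewrite -TP; apply: eq_bigr => j _; apply: eq_bigr => m _.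
by rewrite !mxE.
Qed.

Lemma cubic_indep_coord n t : (t <= n)%N -> cubic_indep n t.
Proof.
by move=> tn; apply: (cubic_indep_fin (@tensor_indep_coord 'I_n)); rewrite card_ord.
Qed.

Lemma cubic_indep_next n t m1 m2 t' : (m1 + m2 <= n)%N -> cubic_indep n t ->
  (t <= 'C(n - m1, 2) + (n - (m1 + m2)))%N ->
  (t <= 'C(n - m2, 2) + (n - (m1 + m2)))%N ->
  (t <= 'C(n, 2) - 'C(m1 + m2, 2) + (n - (m1 + m2)))%N ->
  (t' <= t + (m1 + m2) + 3)%N -> cubic_indep (n + 3) t'.
Proof.
move=> le cP t0 t1 t2 le'; have [P cP'] := cubic_indep_extend le cP t0 t1 t2.
by apply: (cubic_indep_fin cP'); rewrite !card_sum !card_ord.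
Qed.

End CubicCount.

Lemma bin2_double n : ('C(n, 2) * 2 + n = n * n)%N.
Proof.
elim: n => // n IH; rewrite binS bin1; lia.
Qed.

(** With m near 3n/4 cut in halves, the right-hand sides grow like 25/128, 25/128 and 28/128 of n^2,
    against 16/128 for [t]. *)
Lemma cubic_capacity n t (m := (3 * n %/ 4)%N) : (5 <= n)%N ->
  (8 * (t + m) < n ^ 2 + 9 * n)%N ->
  [/\ (t <= 'C(n - uphalf m, 2) + (n - m))%N, (t <= 'C(n - m./2, 2) + (n - m))%N &
      (t <= 'C(n, 2) - 'C(m, 2) + (n - m))%N].
Proof.
rewrite /m {m}.
(* This makes all the floors linear in [a], with eight residues to check. *)
have [a [b [nE b8]]] : exists a b, n = (8 * a + b)%N /\ (b < 8)%N.
  by exists (n %/ 8)%N, (n %% 8)%N; rewrite ltn_mod {1}(divn_eq n 8) mulnC.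
have [-> nE2] : (3 * n %/ 4 = 6 * a + 3 * b %/ 4 /\ n = 8 * a + b)%N by lia.
rewrite nE2 -mulnn {n nE nE2}.
have -> : (8 * a + b - uphalf (6 * a + 3 * b %/ 4) = 5 * a + (b - uphalf (3 * b %/ 4)))%N by lia.
have -> : (8 * a + b - (6 * a + 3 * b %/ 4)./2 = 5 * a + (b - (3 * b %/ 4)./2))%N by lia.
have -> : (8 * a + b - (6 * a + 3 * b %/ 4) = 2 * a + (b - 3 * b %/ 4))%N by lia.
have sq : (a <= a * a)%N by case: a => // a; apply: leq_pmull.
have := bin2_double (5 * a + (b - uphalf (3 * b %/ 4))).
have := bin2_double (5 * a + (b - (3 * b %/ 4)./2)).
have := bin2_double (8 * a + b); have := bin2_double (6 * a + 3 * b %/ 4).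
move: 'C(_ + (_ - uphalf _), 2) => c1.
move: 'C(_ + (_ - _./2), 2) => c2.
move: 'C(8 * a + b, 2) 'C(_, 2) => c3 c4.
case: b b8 => [|[|[|[|[|[|[|[|//]]]]]]]] _;
  set c := (3 * _ %/ 4)%N; vm_compute in c; rewrite {}/c /= => e1 e2 e3 e4 a1 le;
  split; lia.
Qed.

(** From n to n + 3 the bound n^2 + 3n + 5 grows by 6n + 18, which is at most 8(m + 3) because 3n <=
    4m + 3. For n = 3 and 4 at most [n] old points are used, and coordinate points will do. *)
Lemma cubic_split n t : (3 <= n)%N ->
  (8 * t <= (n + 3) ^ 2 + 3 * (n + 3) + 5)%N ->
  exists m1 m2 t', [/\ (m1 + m2 <= n)%N, (t <= t' + (m1 + m2) + 3)%N &
    (t' <= n)%N \/ (8 * t' <= n ^ 2 + 3 * n + 5)%N] /\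
    [/\ (t' <= 'C(n - m1, 2) + (n - (m1 + m2)))%N,
        (t' <= 'C(n - m2, 2) + (n - (m1 + m2)))%N &
        (t' <= 'C(n, 2) - 'C(m1 + m2, 2) + (n - (m1 + m2)))%N].
Proof.
rewrite -mulnn => n3 le; have [n5|n4] := leqP 5 n; last first.
  have [n34|n34] : n = 3 \/ n = 4 by lia.
    by exists 1, 0, 3; rewrite n34 in le *; split; split; [| lia | left | | |].
  by exists 1, 1, 4; rewrite n34 in le *; split; split; [| lia | left | | |].
pose m := (3 * n %/ 4)%N; pose t' := (t - m - 3)%N.
have mb : (3 * n <= 4 * m + 3)%N by rewrite /m; lia.
have le' : (8 * t' <= n ^ 2 + 3 * n + 5)%N.
  by rewrite /t' -!mulnn; move: le mb; move: (m) => y; lia.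
have le2 : (t' = 0 \/ 8 * (t' + m) < n ^ 2 + 9 * n)%N.
  by rewrite /t' -!mulnn; move: le mb; move: (m) => y; lia.
have mE : (uphalf m + m./2 = m)%N by lia.
exists (uphalf m), m./2, t'; rewrite mE; split.
  by split; [rewrite /m; lia | rewrite /t'; lia | right].
by case: le2 => [->//|/cubic_capacity[]].
Qed.

Lemma cubic_indep_general (K : numFieldType) n t :
  (3 <= n)%N -> (8 * t <= n ^ 2 + 3 * n + 5)%N -> cubic_indep K n t.
Proof.
elim/ltn_ind: n t => n IH t n3 le.
have [n5|n6] := leqP n 5.
  (* Up to n = 5 the bound allows at most [n] points. *)
  by rewrite -mulnn in le; apply: cubic_indep_coord; case: n n3 n5 le {IH} => [|[|[|[|[|[|//]]]]]] // _ _; lia.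
have nE : n = (n - 3 + 3)%N by lia.
rewrite nE in le *.
have [|m1 [m2 [t' [[lem let' st'] [c1 c2 c3]]]]] := cubic_split _ le; first lia.
apply: cubic_indep_next lem _ c1 c2 c3 let'; case: st' => [/cubic_indep_coord //|le'].
by apply: IH => //; lia.
Qed.

(** * From cubic tensors to slab forms *)

Section CubicSlab.
Variable K : numFieldType.

Lemma row_mx0l r (x : K) (v : 'rV[K]_r.+1) l :
  (row_mx (0 : 'M_1) v + x *: delta_mx 0 0 : 'rV_r.+2) 0 (lift ord0 l) = v 0 l.
Proof.
have -> : v 0 l = row_tail (row_mx (0 : 'M_1) v : 'rV_r.+2) 0 l by rewrite row_tail_row.
by rewrite row_tailE !mxE andbF mulr0 addr0.
Qed.

Lemma rcat_slab_jac0 r d (c0 : 'rV[K]_(slab_dim r d.+1)) c1 (p : 'rV[K]_r.+2) :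
  (rcat c0 c1 *m slab_jac d.+1 p) 0 0 = p 0 0 * (c1 *m slab_jac d p) 0 0 + (c1 *m slab_mono d p) 0 0.
Proof.
rewrite rcat_slab_jac; set x := (c1 *m slab_mono _ _) 0 0; set u := c1 *m slab_jac _ _.
by rewrite mxE [X in X + _]mxE head_row0 add0r !mxE eqxx mulr1.
Qed.

Lemma rcat_slab_jac_lift r d (c0 : 'rV[K]_(slab_dim r d.+1)) c1 (p : 'rV[K]_r.+2) l :
  (rcat c0 c1 *m slab_jac d.+1 p) 0 (lift ord0 l) =
  (c0 *m slab_jac d.+1 (row_tail p)) 0 l + p 0 0 * (c1 *m slab_jac d p) 0 (lift ord0 l).
Proof.
rewrite rcat_slab_jac; set x := (c1 *m slab_mono _ _) 0 0; set u := c1 *m slab_jac _ _.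
set v := c0 *m _.
by rewrite addrAC mxE row_mx0l [X in _ + X]mxE.
Qed.

Lemma rcat_mono_euler r d (c : 'rV[K]_(slab_dim r d.+1)) (p : 'rV[K]_r.+1) :
  (c *m slab_mono d.+1 p) 0 0 = d.+1%:R^-1 * \sum_l (c *m slab_jac d.+1 p) 0 l * p 0 l.
Proof.
have : (c *m slab_jac d.+1 p *m p^T) 0 0 = d.+1%:R * (c *m slab_mono d.+1 p) 0 0.
  by rewrite -mulmxA slab_euler -scalemxAr mxE.
rewrite mxE (eq_bigr (fun l => (c *m slab_jac d.+1 p) 0 l * p 0 l)) => [->|l _]; last first.
  by rewrite [X in _ * X]mxE.
by rewrite mulKf ?pnatr_eq0.
Qed.

Lemma linear_jac r (v : 'I_r.+1 -> K) : exists c : 'rV_(slab_dim r 1),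
  forall p l, (c *m slab_jac 1 p) 0 l = v l.
Proof.
elim: r v => [|r IHr] v.
  by exists (const_mx (v 0)) => p l; rewrite ord1 mxE big_ord1 !mxE mulr1.
have [c0 c0P] := IHr (fun l => v (lift ord0 l)).
exists (rcat c0 (const_mx (v 0) : 'rV_(slab_dim r.+1 0))) => p l.
case: (unliftP ord0 l) => [l'|] ->.
  by rewrite rcat_slab_jac_lift slab_jac0 mulmx0 c0P mxE mulr0 addr0.
by rewrite rcat_slab_jac0 slab_jac0 mulmx0 mxE mulr0 add0r mxE big_ord1 !mxE mulr1.
Qed.

Lemma quadric_jac r (Q : 'I_r.+1 -> 'I_r.+1 -> K) :
  (forall j l, Q j l = Q l j) -> Q ord_max ord_max = 0 ->
  exists c : 'rV_(slab_dim r 2), forall p l,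
    (c *m slab_jac 2 p) 0 l = 2 * \sum_j p 0 j * Q j l.
Proof.
elim: r Q => [|r IHr] Q sQ Q0.
  have ord1E (x : 'I_1) : x = ord_max by apply: val_inj; case: x => [[]].
  have Qz j k : Q j k = 0 by rewrite (ord1E j) (ord1E k).
  by exists 0 => p l; rewrite mul0mx mxE big_ord1 Qz !mulr0.
have lmax : lift ord0 (@ord_max r) = ord_max by apply: val_inj.
have [||c0 c0P] := IHr (fun j l => Q (lift ord0 j) (lift ord0 l)); first by move=> *; apply: sQ.
  by rewrite lmax.
have [c1 c1P] := linear_jac (fun l => if l == ord0 then Q 0 0 else 2 * Q 0 l).
exists (rcat c0 c1) => p l; case: (unliftP ord0 l) => [l'|] ->.
  rewrite rcat_slab_jac_lift c0P c1P [in RHS]big_ord_recl /=.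
  rewrite (eq_bigr (fun j => p 0 (lift ord0 j) * Q (lift ord0 j) (lift ord0 l'))); last first.
    by move=> j _; rewrite row_tailE.
  by ring.
rewrite rcat_slab_jac0 rcat_mono_euler c1P (eq_bigr (fun l => (if l == ord0 then Q 0 0 else 2 * Q 0 l) * p 0 l)); last first.
  by move=> j _; rewrite c1P.
rewrite [in LHS]big_ord_recl [in RHS]big_ord_recl /= invr1 mul1r.
rewrite (eq_bigr (fun j => 2 * (p 0 (lift ord0 j) * Q (lift ord0 j) ord0))); last first.
  by move=> j _; rewrite (sQ 0) mulrAC -mulrA.
by rewrite -mulr_sumr; ring.
Qed.

(** The hypothesis at [ord_max] excludes the monomials divisible by x0^2. Splitting off the newest
    variable x leaves a cubic in the others and x times a quadric. *)
Lemma tensor_jac r (T : 'I_r.+1 -> 'I_r.+1 -> 'I_r.+1 -> K) : sym3 T ->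
  (forall l, T ord_max ord_max l = 0) ->
  exists c : 'rV_(slab_dim r 3), forall p l,
    (c *m slab_jac 3 p) 0 l = 3 * tensor_eval T (fun j => p 0 j) l.
Proof.
elim: r T => [|r IHr] T sT T0.
  have ord1E (x : 'I_1) : x = ord_max by apply: val_inj; case: x => [[]].
  have Tz j k l : T j k l = 0 by rewrite (ord1E j) (ord1E k).
  by exists 0 => p l; rewrite mul0mx mxE /tensor_eval !big_ord1 Tz !mulr0.
have lmax : lift ord0 (@ord_max r) = ord_max by apply: val_inj.
have [||c0 c0P] := IHr (fun j k l => T (lift ord0 j) (lift ord0 k) (lift ord0 l)).
- by move=> j k l; apply: sT.
- by move=> l; rewrite lmax.
have s1 j k l : T j k l = T k j l by have [] := sT j k l.
have s2 j k l : T j k l = T j l k by have [] := sT j k l.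
(* The part of T(p, p, p) divisible by x, divided by x, is x^2 T_000 + 3 x y_j T_00j + 3 y_j y_l
   T_0jl, summed over j and l; [Q] is its symmetric matrix. *)
pose Q j l := if (j == ord0) && (l == ord0) then T 0 0 0
  else if (j == ord0) || (l == ord0) then 3 / 2 * T 0 j l else 3 * T 0 j l.
have [||c1 c1P] := @quadric_jac r.+1 Q.
- by move=> j l; rewrite /Q andbC orbC s2.
- by rewrite /Q /= s1 s2 T0 mulr0.
have Q00 : Q 0 0 = T 0 0 0 by [].
have Q0l l : Q 0 (lift ord0 l) = 3 / 2 * T 0 0 (lift ord0 l) by [].
have Ql0 l : Q (lift ord0 l) 0 = 3 / 2 * T 0 0 (lift ord0 l) by rewrite /Q /= s2.
have Qll j l : Q (lift ord0 j) (lift ord0 l) = 3 * T 0 (lift ord0 j) (lift ord0 l) by [].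
pose x (p : 'rV[K]_r.+2) : K := p 0 0.
pose y (p : 'rV[K]_r.+2) (j : 'I_r.+1) : K := p 0 (lift ord0 j).
pose S1 p l : K := \sum_j y p j * T 0 (lift ord0 j) l.
pose S2 p l : K := \sum_j \sum_k y p j * y p k * T (lift ord0 j) (lift ord0 k) l.
have tevE (p : 'rV[K]_r.+2) l : tensor_eval T (fun j => p 0 j) l = x p ^+ 2 * T 0 0 l + 2 * x p * S1 p l + S2 p l.
  rewrite /tensor_eval big_ord_recl.
  have -> : \sum_m p 0 ord0 * p 0 m * T ord0 m l = x p ^+ 2 * T 0 0 l + x p * S1 p l.
    rewrite big_ord_recl expr2; congr (_ + _); rewrite mulr_sumr.
    by apply: eq_bigr => i _; rewrite mulrA.
  rewrite (eq_bigr (fun j => x p * (y p j * T 0 (lift ord0 j) l) +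
     \sum_k y p j * y p k * T (lift ord0 j) (lift ord0 k) l)); last first.
    move=> j _; rewrite big_ord_recl (s1 (lift ord0 j)) -/(x p) -/(y p j).
    by congr (_ + _); ring.
  by rewrite big_split /= -mulr_sumr -/(S1 p l) -/(S2 p l); ring.
have c1l p l : (c1 *m slab_jac 2 p) 0 (lift ord0 l) =
    3 * (x p * T 0 0 (lift ord0 l) + 2 * S1 p (lift ord0 l)).
  rewrite c1P big_ord_recl Q0l -/(x p).
  rewrite (eq_bigr (fun j => 3 * (y p j * T 0 (lift ord0 j) (lift ord0 l)))); last first.
    by move=> j _; rewrite Qll mulrCA.
  by rewrite -mulr_sumr -/(S1 p _); field.
have c10 p : (c1 *m slab_jac 2 p) 0 0 = 2 * x p * T 0 0 0 + 3 * S1 p 0.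
  rewrite c1P big_ord_recl Q00 -/(x p).
  rewrite (eq_bigr (fun j => 3 / 2 * (y p j * T 0 (lift ord0 j) 0))); last first.
    by move=> j _; rewrite Ql0 mulrCA (s2 0 0).
  by rewrite -mulr_sumr -/(S1 p _); field.
exists (rcat c0 c1) => p l; rewrite tevE; case: (unliftP ord0 l) => [l'|] ->.
  rewrite rcat_slab_jac_lift c0P c1l -/(x p).
  have -> : tensor_eval (fun j k l => T (lift ord0 j) (lift ord0 k) (lift ord0 l))
      (fun j => row_tail p 0 j) l' = S2 p (lift ord0 l').
    by apply: eq_bigr => j _; apply: eq_bigr => k _; rewrite !row_tailE.
  by ring.
rewrite rcat_slab_jac0 rcat_mono_euler big_ord_recl c10 -/(x p).
rewrite (eq_bigr (fun l => 3 * (x p * (y p l * T 0 (lift ord0 l) 0))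
   + 6 * (S1 p (lift ord0 l) * y p l))); last first.
  by move=> l' _; rewrite c1l -/(y p l') (s2 0 0); ring.
rewrite big_split /= -!mulr_sumr -/(S1 p 0).
have -> : \sum_i S1 p (lift ord0 i) * y p i = S2 p 0.
  rewrite /S1; under eq_bigr do rewrite mulr_suml.
  apply: eq_bigr => j _; apply: eq_bigr => k _.
  by rewrite [T 0 _ _]s1 [T _ 0 _]s2 [T (lift ord0 k) _ _]s1; ring.
by field.
Qed.

(** In degree 3 the point of multiplicity d-1 is itself a double point: a zero gradient at the
    coordinate point [P a0] leaves slab forms, and the remaining points keep arbitrary gradients. *)
Lemma indep_points_tensor r q (I A : finType) (P : A -> I -> K) a0 i0 : tensor_indep P ->
  (forall i, P a0 i = (i == i0)%:R) -> #|I| = r.+1 -> (q < #|A|)%N -> indep_points K r 3 q.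
Proof.
move=> cP P0 cI qA.
pose f (i : 'I_r.+1) : I := enum_val (tperm (enum_rank i0) (cast_ord (esym cI) ord_max) (cast_ord (esym cI) i)).
have fb : bijective f.
  apply: (bij_comp (enum_val_bij I)); apply: (bij_comp (injF_bij perm_inj)).
  by exists (cast_ord cI) => x; rewrite ?cast_ordK ?cast_ordKV.
have fmax : f ord_max = i0 by rewrite /f tpermR enum_rankK.
have qA' : (q <= #|[set~ a0]|)%N by rewrite cardsC1; lia.
pose h (a : 'I_q) : A := enum_val (widen_ord qA' a).
have ha a : h a != a0 by have := enum_valP (widen_ord qA' a); rewrite !inE.
exists (\matrix_(a, j) P (h a) (f j)) => W.
have [T [sT TP]] := cP (fun a i => if a == a0 then 0 else
  if [pick b | h b == a] is Some b then
    3^-1 * (if [pick j | f j == i] is Some j then W b j else 0) else 0).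
have [||c cE] := @tensor_jac r (fun j k l => T (f j) (f k) (f l)).
- by move=> j k l; apply: sT.
- move=> l; rewrite fmax; have := TP a0 (f l); rewrite eqxx => <-.
  rewrite -(tensor_eval_delta T i0); apply: eq_bigr => j _; apply: eq_bigr => m _.
  by rewrite !P0.
exists c => a; apply/rowP=> l; rewrite cE.
have -> : tensor_eval (fun j k l0 => T (f j) (f k) (f l0))
    (fun j => row a (\matrix_(a1, j0) P (h a1) (f j0)) 0 j) l = tensor_eval T (P (h a)) (f l).
  have [f' fK f'K] := fb.
  rewrite /tensor_eval [RHS](reindex f) /=; last by exists f' => x _.
  apply: eq_bigr => j _; rewrite [RHS](reindex f) /=; last by exists f' => x _.
  by apply: eq_bigr => k _; rewrite !mxE.
rewrite TP (negPf (ha a)); case: pickP => [b /eqP|/(_ a)]; last by rewrite eqxx.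
move=> /enum_val_inj /widen_ord_inj ->.
case: pickP => [j /eqP/(bij_inj fb) ->|/(_ l)]; last by rewrite eqxx.
by rewrite mulrA divff ?pnatr_eq0 // mul1r mxE.
Qed.

Lemma indep_points_cubic r q : (3 <= r)%N -> (8 * q.+1 <= r ^ 2 + 5 * r + 9)%N -> indep_points K r 3 q.
Proof.
move=> r3 le; have [r4|r5] := leqP r 4.
  apply: (@indep_points_tensor r q 'I_r.+1 'I_r.+1 _ 0 0 (@tensor_indep_coord K 'I_r.+1)) => //.
    by rewrite card_ord.
  by rewrite card_ord; rewrite -mulnn in le; case: r r3 r4 le => [|[|[|[|[|//]]]]] // _ _; lia.
have le1 : (8 * q.+1 <= (r - 2 + 3) ^ 2 + 3 * (r - 2 + 3) + 5)%N.
  have -> : (r - 2 + 3 = r.+1)%N by lia.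
  by rewrite -!mulnn in le *; lia.
(* The last extension is made explicitly, because one of its points is a new coordinate point; it
   becomes the point of multiplicity 2. *)
have [|m1 [m2 [t' [[lem let' st'] [c1 c2 c3]]]]] := cubic_split _ le1; first lia.
have cP0 : cubic_indep K (r - 2) t'.
  by case: st' => [/cubic_indep_coord //|le']; apply: cubic_indep_general => //; lia.
have [P cP] := cubic_indep_extend lem cP0 c1 c2 c3.
apply: (@indep_points_tensor r q _ _ _ (inr ord0) (inr ord0) cP) => //.
  by rewrite card_sum !card_ord; lia.
by rewrite !card_sum !card_ord; lia.
Qed.

End CubicSlab.

(** * The induction *)

Section Numerics.
Local Open Scope nat_scope.

Lemma slab_dim_deg0 r : slab_dim r 0 = 1.
Proof. by case: r. Qed.

Lemma slab_dim_deg1 r : slab_dim r 1 = r.+1.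
Proof. by elim: r => // r IH; rewrite slab_dimS IH slab_dim_deg0 addn1. Qed.

Lemma slab_dim_deg2 r : 2 * slab_dim r 2 = r * (r + 3).
Proof. by elim: r => // r IH; rewrite slab_dimS slab_dim_deg1; lia. Qed.

Lemma slab_dim_deg3 r : 6 * slab_dim r 3 = r * (r + 1) * (r + 5).
Proof. by elim: r => // r IH; rewrite slab_dimS; have := slab_dim_deg2 r.+1; lia. Qed.

Lemma slab_dim_deg4 r : 24 * slab_dim r 4 = r * (r + 1) * (r + 2) * (r + 7).
Proof. by elim: r => // r IH; rewrite slab_dimS; have := slab_dim_deg3 r.+1; lia. Qed.

Lemma slab_dim_deg5 r : 120 * slab_dim r 5 = r * (r + 1) * (r + 2) * (r + 3) * (r + 9).
Proof. by elim: r => // r IH; rewrite slab_dimS; have := slab_dim_deg4 r.+1; lia. Qed.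

Lemma slab_dim_deg6 r : 720 * slab_dim r 6 = r * (r + 1) * (r + 2) * (r + 3) * (r + 4) * (r + 11).
Proof. by elim: r => // r IH; rewrite slab_dimS; have := slab_dim_deg5 r.+1; lia. Qed.

Lemma slab_dim_line d : slab_dim 1 d.+1 = 2.
Proof. by elim: d => // d IH; rewrite slab_dimS IH. Qed.

Lemma slab_dim_plane d : slab_dim 2 d = 2 * d + 1.
Proof. by elim: d => // d IH; rewrite slab_dimS IH slab_dim_line; lia. Qed.

Lemma slab_dim_space d : slab_dim 3 d = (d + 1) * (d + 1).
Proof. by elim: d => // d IH; rewrite slab_dimS IH slab_dim_plane; lia. Qed.

Lemma slab_dim_ratio r d : slab_dim r d.+2 <= (r + 2) * slab_dim r d.+1.
Proof. by elim: r d => // r IH d; rewrite slab_dimS; have := IH d; rewrite !slab_dimS; nia. Qed.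

Lemma slab_dim_leq r d d' : d <= d' -> slab_dim r.+1 d <= slab_dim r.+1 d'.
Proof. by move/subnK <-; elim: (d' - d) => // n IH; rewrite addSn slab_dimS; lia. Qed.

(** With u(d) = [slab_dim r.+1 d], the excess (r+2) u(d+1) - u(d+2) is nondecreasing in d, so an
    estimate in one degree extends to all higher ones. *)
Lemma ratio_mono r d d' : d <= d' ->
  r.+2 * slab_dim r.+1 d.+1 + slab_dim r.+1 d'.+2 <= r.+2 * slab_dim r.+1 d'.+1 + slab_dim r.+1 d.+2.
Proof.
move/subnK <-; elim: (d' - d) => // n IH; rewrite addSn.
have := slab_dim_ratio r (n + d).+1.
rewrite [slab_dim r.+1 (n + d).+3]slab_dimS [X in _ <= _ * X + _]slab_dimS; move: IH; lia.
Qed.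

(** The bound [k_bound] in natural numbers; a negative bound becomes 0. *)
Definition kmax r d := slab_dim r d %/ r.+1 - (r - 2).

Lemma div_gap a r : 0 < r -> r.+1 * (r ^ 2 - r - 1) <= a -> a %/ r.+1 + (r - 2) <= a %/ r.
Proof.
move=> r0 le; rewrite leq_divRL // mulnDl.
have := leq_trunc_div a r.+1; move: (a %/ r.+1) => x.
rewrite -mulnn in le.
nia.
Qed.

End Numerics.

(** * Induction on the dimension and the degree *)

Section Main.
Variable K : numFieldType.
Local Open Scope nat_scope.

Lemma indep_points0 r d : indep_points K r d 0.
Proof. by exists 0%R => W; exists 0%R => -[]. Qed.

Lemma corank_from_indep r d k q z : indep_points K r d.+1 k -> k <= q ->
  slab_dim r d.+1 <= k * r.+1 + (z + (q - k).*2) -> corank_le K r d.+1 q z.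
Proof.
by move=> /indep_corank sk kq /sk /corank_le_iter; rewrite subnKC.
Qed.

Lemma indep_kmax_plane d : indep_points K 2 d (kmax 2 d).
Proof.
elim/ltn_ind: d => d IH; rewrite /kmax slab_dim_plane subn0.
case: d IH => [_|[_|[_|d IH]]]; [exact: indep_points0| exact: indep_points1| exact: indep_points1|].
set k := _ %/ 3.
have kE : k = 1 + (k - 1) by rewrite /k; lia.
(* One point goes to the line, and [z] is as large as the count permits. *)
rewrite kE; apply: (@indep_points_horace K 1 d.+1 1 (k - 1) (slab_dim 2 d.+2 - ((k - 1) * 3 + 1))).
- exact: indep_points1.
- have := IH d.+2 (leqnn _); rewrite /kmax slab_dim_plane subn0; apply: indep_points_le.
  by rewrite /k; lia.
- have := IH d.+1 (ltnW (leqnn _)); rewrite /kmax slab_dim_plane subn0 => h.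
  apply: (corank_from_indep h); rewrite ?slab_dim_plane /k; lia.
by rewrite slab_dim_plane /k; lia.
Qed.

Lemma indep_kmax_step s d (q := kmax s.+1 d.+2 - kmax s d.+2) : 2 <= s ->
  kmax s d.+2 <= kmax s.+1 d.+2 ->
  indep_points K s d.+2 (kmax s d.+2) -> indep_points K s.+1 d.+1 q -> corank_le K s.+1 d q s ->
  indep_points K s.+1 d.+2 (kmax s.+1 d.+2).
Proof.
move=> s2 le Sa Sq Kq.
have [X0|X1] := leqP (slab_dim s.+1 d.+2 %/ s.+2) (s.+1 - 2).
  rewrite (_ : kmax s.+1 d.+2 = 0); first exact: indep_points0.
  by rewrite /kmax; lia.
rewrite -(subnKC le) -/q; apply: indep_points_horace Sa Sq Kq _.
have := leq_trunc_div (slab_dim s.+1 d.+2) s.+2.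
rewrite [X in _ <= X -> _]slab_dimS; have := ltn_ceil (slab_dim s d.+2) (ltn0Sn s).
move: le; rewrite /q /kmax; move: X1.
move: (_ %/ s.+2) (_ %/ s.+1) => X Y.
move: (slab_dim s d.+2) (slab_dim s.+1 d.+1) => a be.
move=> X1; set k := X - _; set k' := Y - _ => le ltY leX.
have {leX} kX : k * s.+2 + (s.+1 - 2) * s.+2 <= a + be.
  by rewrite -mulnDl subnK //; lia.
have k'Y : a < (k' + (s - 2)).+1 * s.+1.
  by apply: leq_trans ltY _; rewrite leq_mul2r; lia.
have le2 : k' * s.+2 <= k * s.+2 by rewrite leq_mul2r le orbT.
rewrite mulnBl; move: (k) (k') le2 kX k'Y => x y.
by case: s s2 {q le ltY X1 k k'} => [|[|s]] // _; lia.
Qed.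

(** Keeps the number of residual points within the bound in one degree less, where the induction
    hypothesis applies. *)
Lemma kmax_le_prev a be s : 2 <= s -> a %/ s.+2 + (s.+1 - 2) <= a %/ s.+1 ->
  (a + be) %/ s.+2 - (s.+1 - 2) - (a %/ s.+1 - (s - 2)) <= be %/ s.+2 - (s.+1 - 2).
Proof. by move=> s2 gap; have := leq_divDl s.+2 a be; lia. Qed.

Lemma kmax4E r : kmax r 4 = r * (r + 2) * (r + 7) %/ 24 - (r - 2).
Proof.
rewrite /kmax -(@divnMl 24) // slab_dim_deg4 -[in RHS](@divnMr r.+1) //.
by congr (_ %/ _ - _); lia.
Qed.

Lemma kmax5E r : kmax r 5 = r * (r + 2) * (r + 3) * (r + 9) %/ 120 - (r - 2).
Proof.
rewrite /kmax -(@divnMl 120) // slab_dim_deg5 -[in RHS](@divnMr r.+1) //.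
by congr (_ %/ _ - _); lia.
Qed.

(** In degree 4 the residual points must be independent for cubics and numerous enough to leave few
    quadrics; the last two conclusions provide this. *)
Lemma kmax4_diff s (q := kmax s.+1 4 - kmax s 4) : 2 <= s ->
  [/\ kmax s 4 <= kmax s.+1 4, 8 * q.+1 <= s.+1 ^ 2 + 5 * s.+1 + 9 &
      if s == 2 then q = 2 else s.+1 <= q].
Proof.
rewrite /q !kmax4E -!mulnn => s2.
have := leq_trunc_div (s.+1 * (s.+1 + 2) * (s.+1 + 7)) 24.
have := @ltn_ceil (s.+1 * (s.+1 + 2) * (s.+1 + 7)) 24 isT.
have := leq_trunc_div (s * (s + 2) * (s + 7)) 24.
have := @ltn_ceil (s * (s + 2) * (s + 7)) 24 isT.
move: (_ %/ 24) (_ %/ 24) => X Y y1 y2 x1 x2.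
have sq : s * s * s = s * s * s by [].
have [s5|s4] := leqP 5 s; last first.
  by case: s s2 s4 y1 y2 x1 x2 {q sq} => [|[|[|[|[|//]]]]] //= _ _ y1 y2 x1 x2; split; lia.
have sq5 : 5 * s <= s * s by rewrite leq_mul2r s5 orbT.
have cu5 : 5 * (s * s) <= s * s * s by rewrite -mulnA leq_mul2r s5 orbT.
case: eqP => [|_]; first lia.
split; lia.
Qed.

Lemma indep_kmax4 s : 2 <= s -> indep_points K s 4 (kmax s 4) -> indep_points K s.+1 4 (kmax s.+1 4).
Proof.
move=> s2 Sa; have [le cub q_ge] := kmax4_diff s2.
apply: indep_kmax_step => //; first by apply: indep_points_cubic.
(* In P^r, [r] successive cone points leave no quadric. *)
have quad r : corank_le K r 2 r 0.
  by elim: r => [|r /corank_quadrics//]; exists 0%R.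
case: eqP q_ge => [->|_ q_ge]; last first.
  by apply: corank_le_leq q_ge _; apply: corank_le_weaken (quad s.+1).
(* In P^3 the two residual points leave the slab quadrics of a line, of dimension 2, which is
   [s]. *)
move=> ->; do 2!apply: corank_quadrics.
by exists 0%R; rewrite /=; apply: leq_trans (leq_addl _ _).
Qed.

Lemma slab_dim_gap s d : 2 <= s -> 5 <= d ->
  slab_dim s d %/ s.+2 + (s.+1 - 2) <= slab_dim s d %/ s.+1.
Proof.
move=> s2 d5.
have big d' : d' <= d -> s.+2 * (s.+1 ^ 2 - s.+1 - 1) <= slab_dim s d' ->
    slab_dim s d %/ s.+2 + (s.+1 - 2) <= slab_dim s d %/ s.+1.
  move=> le le'; apply: div_gap => //; apply: leq_trans le' _.
  by case: s s2 => // s _; apply: slab_dim_leq.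
case: s s2 big => [//|[//|[|[|[|[|s]]]]]] _ big.
- by rewrite slab_dim_plane; lia.
- have [d7|d7] := leqP 7 d; first by apply: big d7 _; rewrite slab_dim_space.
  by case: d d5 d7 {big} => [|[|[|[|[|[|[|//]]]]]]].
- have [d6|d6] := leqP 6 d; first exact: big d6 _.
  by case: d d5 d6 {big} => [|[|[|[|[|[|//]]]]]].
- have [d6|d6] := leqP 6 d; first exact: big d6 _.
  by case: d d5 d6 {big} => [|[|[|[|[|[|//]]]]]].
apply: big d5 _; rewrite -(@leq_pmul2l 120) // slab_dim_deg5 -mulnn.
have -> : s.+4.+3 * s.+4.+3 - s.+4.+3 - 1 = s * s + 13 * s + 41 by lia.
lia.
Qed.

(** [q3] points are independent for cubics by [indep_points_cubic]; each of the other q - q3 lowers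
    the dimension by 2, until at most [s] is left. *)
Lemma kmax5_diff s (r := s.+1) (q := kmax r 5 - kmax s 5)
    (q3 := (r ^ 2 + 5 * r + 9) %/ 8 - 1) : 2 <= s ->
  [/\ kmax s 5 <= kmax r 5, q3 <= q &
      slab_dim r 3 <= q3 * r.+1 + (s + (q - q3).*2)].
Proof.
move=> s2; rewrite -(@leq_pmul2l 6 (slab_dim r 3)) // slab_dim_deg3.
rewrite /q !kmax5E /q3 -mulnn /r {q q3 r}.
have := leq_trunc_div (s.+1 * (s.+1 + 2) * (s.+1 + 3) * (s.+1 + 9)) 120.
have := @ltn_ceil (s.+1 * (s.+1 + 2) * (s.+1 + 3) * (s.+1 + 9)) 120 isT.
have := leq_trunc_div (s * (s + 2) * (s + 3) * (s + 9)) 120.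
have := @ltn_ceil (s * (s + 2) * (s + 3) * (s + 9)) 120 isT.
have := leq_trunc_div (s.+1 * s.+1 + 5 * s.+1 + 9) 8.
have := @ltn_ceil (s.+1 * s.+1 + 5 * s.+1 + 9) 8 isT.
case: (leqP 4 s) => s4; last first.
  by case: s s2 s4 => [|[|[|[|//]]]] // _ _ _ _ _ _ _ _; split.
have [t {s2 s4}->] : exists t, s = t + 4 by exists (s - 4); lia.
move: (_ %/ 120) (_ %/ 120) (_ %/ 8) => X Y Z z1 z2 y1 y2 x1 x2.
have := leq0n (t * t); have := leq0n (t * t * t); move=> t3 t2.
have [W ZE] : exists W, Z = W + 1 by exists (Z - 1); lia.
rewrite {}ZE in z1 z2 *.
have z3 : t * ((t + 4).+1 * (t + 4).+1 + 5 * (t + 4).+1 + 9) <= t * ((W + 2) * 8).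
  by rewrite leq_mul2l; lia.
have le1 : Y - (t + 4 - 2) <= X - ((t + 4).+1 - 2) by lia.
have le2 : W + 1 - 1 <= X - ((t + 4).+1 - 2) - (Y - (t + 4 - 2)) by lia.
split=> //.
lia.
Qed.

Lemma div_gap2 a b r : 0 < r ->
  r * r.+1 * (r ^ 2 - 3 * r + 5) + 2 * r ^ 2 + 2 * a <= 2 * (r * b) -> 3 <= r ->
  2 * (a %/ r) + (r ^ 2 - r - 1) <= 2 * ((a + b) %/ r.+1) + 2 * (r - 3).
Proof.
move=> r0; rewrite -mulnn => le r3.
have := leq_trunc_div a r; have := @ltn_ceil (a + b) r.+1 isT.
move: (_ %/ r.+1) (_ %/ r) => X Y leX leY.
have [t rE] : exists t, r = t + 3 by exists (r - 3); lia.
have leq1 : (t + 3) * (t + 4) * (2 * Y + t * t + 3 * t + 5) <= (t + 3) * (t + 4) * (2 * X).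
  move: le; rewrite rE in leX leY *.
  have -> : (t + 3) * (t + 3) - 3 * (t + 3) + 5 = t * t + 3 * t + 5 by lia.
  have : 2 * (t + 4) * (Y * (t + 3)) <= 2 * (t + 4) * a by rewrite leq_mul2l leY orbT.
  have : 2 * (t + 3) * (a + b) <= 2 * (t + 3) * (X * (t + 4) + (t + 3)).
    by rewrite leq_mul2l; lia.
  lia.
rewrite leq_pmul2l in leq1; last by rewrite muln_gt0; lia.
have -> : r * r - r - 1 = t * t + 5 * t + 5 by rewrite rE; lia.
lia.
Qed.

(** In degree d, [kmax s.+1 d] points leave at most s(s+2) - 1 dimensions beyond rounding and slack,
    so s^2 + s - 1 above [s]. This is (s+1)^2 - (s+1) - 1, and the points beyond that bound, worth
    two conditions each, must absorb it. *)
Lemma slab_dim_gap2 s d : 3 <= s -> 4 <= d ->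
  2 * (slab_dim s d.+2 %/ s.+1) + (s.+1 ^ 2 - s.+1 - 1) <=
  2 * ((slab_dim s d.+2 + slab_dim s d.+1) %/ s.+2) + 2 * (s.+1 - 3).
Proof.
move=> s3 d4.
have big d' : d' <= d ->
    s.+1 * s.+2 * (s.+1 ^ 2 - 3 * s.+1 + 5) + 2 * s.+1 ^ 2 + 2 * slab_dim s d'.+2
      <= 2 * (s.+1 * slab_dim s d'.+1) ->
    2 * (slab_dim s d.+2 %/ s.+1) + (s.+1 ^ 2 - s.+1 - 1) <=
    2 * ((slab_dim s d.+2 + slab_dim s d.+1) %/ s.+2) + 2 * (s.+1 - 3).
  move=> le le'; apply: div_gap2; [by [] | | exact: leqW].
  by case: s s3 le' => // s _; have := ratio_mono s le; lia.
case: s s3 big => [//|[//|[//|[|s]]]] _ big.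
  have [d5|d5] := leqP 5 d; first by apply: big d5 _; rewrite !slab_dim_space.
  by have -> : d = 4 by lia.
apply: big d4 _; rewrite -(@leq_pmul2l 720) //.
have := slab_dim_deg6 s.+4; have := slab_dim_deg5 s.+4; rewrite -!mulnn.
have -> : s.+4.+1 * s.+4.+1 - 3 * s.+4.+1 + 5 = s * s + 7 * s + 15 by lia.
move: (slab_dim _ 5) (slab_dim _ 6) => b a eb ea.
have -> : 720 * (2 * (s.+4.+1 * b)) = 12 * s.+4.+1 * (120 * b) by lia.
rewrite (mulnDr 720 _ (2 * a)) (mulnCA 720 2 a) ea eb.
have := leq0n (s * s); have := leq0n (s * s * s); have := leq0n (s * s * s * s).
have := leq0n (s * s * s * s * s); have := leq0n (s * s * s * s * s * s).
lia.
Qed.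

Lemma kmax_prev s d : 2 <= s -> 5 <= d.+1 ->
  kmax s.+1 d.+1 - kmax s d.+1 <= kmax s.+1 d.
Proof. by move=> s2 d5; apply: kmax_le_prev (slab_dim_gap s2 d5). Qed.

Lemma indep_kmax5 s : 2 <= s -> indep_points K s 5 (kmax s 5) -> indep_points K s.+1 4 (kmax s.+1 4) ->
  indep_points K s.+1 5 (kmax s.+1 5).
Proof.
move=> s2 Sa Sb; have [le q3q KZq] := kmax5_diff s2.
apply: indep_kmax_step => //; first exact: indep_points_le (kmax_prev s2 _) Sb.
apply: corank_from_indep q3q KZq; apply: indep_points_cubic => //.
by rewrite -!mulnn; lia.
Qed.

Lemma kmax_step s d (q := kmax s.+1 d.+2 - kmax s d.+2) : 3 <= s -> 4 <= d ->
  [/\ kmax s d.+2 <= kmax s.+1 d.+2, kmax s.+1 d <= q &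
    slab_dim s.+1 d <= kmax s.+1 d * s.+2 + (s + (q - kmax s.+1 d).*2)].
Proof.
move=> s3 d4; have f1 := @slab_dim_gap s d.+2 (ltnW s3) (leqW d4).
have f2 := slab_dim_gap2 s3 d4.
have uE : slab_dim s.+1 d.+2 = slab_dim s d.+2 + slab_dim s d.+1 + slab_dim s.+1 d by rewrite !slab_dimS addnA.
have leX : (slab_dim s d.+2 + slab_dim s d.+1) %/ s.+2 + slab_dim s.+1 d %/ s.+2 <=
    slab_dim s.+1 d.+2 %/ s.+2.
  by rewrite leq_divRL // uE mulnDl leq_add ?leq_trunc_div.
have ltZ := @ltn_ceil (slab_dim s.+1 d) s.+2 isT.
rewrite /q /kmax {q uE}.
move: f1 f2 leX ltZ.
move: (slab_dim s.+1 d.+2 %/ s.+2) => X.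
move: ((slab_dim s d.+2 + slab_dim s d.+1) %/ s.+2) => W.
move: (slab_dim s d.+2 %/ s.+1) => Y; move: (slab_dim s d.+2 %/ s.+2) => V.
move: (slab_dim s.+1 d %/ s.+2) => Z; move: (slab_dim s.+1 d) => e.
have [t {s3 s}->] : exists t, s = t + 3 by exists (s - 3); lia.
rewrite -mulnn => f1 f2 leX ltZ.
have t2 := leq0n (t * t).
have le1 : Y - (t + 3 - 2) <= X - ((t + 3).+1 - 2) by lia.
have le2 : Z - ((t + 3).+1 - 2) <= X - ((t + 3).+1 - 2) - (Y - (t + 3 - 2)) by lia.
split=> //.
have [Zt|tZ] := leqP (t + 2) Z.
  have [z {le1 le2} ZE] : exists z, Z = z + (t + 2) by exists (Z - (t + 2)); lia.
  rewrite {Zt}ZE in ltZ leX *.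
  have -> : z + (t + 2) - ((t + 3).+1 - 2) = z by lia.
  lia.
have -> : Z - ((t + 3).+1 - 2) = 0 by lia.
have : Z * (t + 3) <= (t + 1) * (t + 3) by rewrite leq_mul2r; lia.
lia.
Qed.

Lemma indep_kmax6 s d : 2 <= s -> 4 <= d -> indep_points K s d.+2 (kmax s d.+2) ->
  indep_points K s.+1 d.+1 (kmax s.+1 d.+1) -> indep_points K s.+1 d (kmax s.+1 d) ->
  indep_points K s.+1 d.+2 (kmax s.+1 d.+2).
Proof.
move=> s2 d4 Sa Sb Sc.
have [le kq KZq] : let q := kmax s.+1 d.+2 - kmax s d.+2 in
  [/\ kmax s d.+2 <= kmax s.+1 d.+2, kmax s.+1 d <= q &
    slab_dim s.+1 d <= kmax s.+1 d * s.+2 + (s + (q - kmax s.+1 d).*2)].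
  case: (leqP 3 s) => s3; first exact: kmax_step.
  have {s2 s3 Sa Sb Sc}-> : s = 2 by lia.
  rewrite /kmax slab_dim_plane !slab_dim_space /= => {s}.
  have -> : (d.+2 + 1) * (d.+2 + 1) = (d + 1) * (d + 1) + (d + 2) * 4 by lia.
  (* In P^3 the dimensions are squares, and their residues modulo 4 control the floors. *)
  have sq4 : (d + 1) * (d + 1) %% 4 <= 1.
    have [c [b [-> b2]]] : exists c b, d + 1 = 2 * c + b /\ b < 2.
      by exists ((d + 1) %/ 2), ((d + 1) %% 2); rewrite ltn_mod {1}(divn_eq (d + 1) 2) mulnC.
    by case: b b2 => [|[|//]] _; lia.
  have M25 : 5 * 5 <= (d + 1) * (d + 1) by rewrite leq_mul // addn1.
  rewrite divnDMl //.
  move: ((d + 1) * (d + 1)) sq4 M25 => M sq4 M25.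
  by split; lia.
apply: indep_kmax_step => //; first by apply: indep_points_le (kmax_prev s2 (leqW (d4 : 5 <= d.+1))) Sb.
by case: d d4 {Sa Sb le} Sc kq KZq => // d d4 Sc kq KZq; apply: corank_from_indep Sc kq KZq.
Qed.

Theorem indep_kmax r d : 2 <= r -> 4 <= d -> indep_points K r d (kmax r d).
Proof.
case: r => [//|[//|r]] _; elim: r d => [|r IHr] d; first by move=> _; apply: indep_kmax_plane.
elim/ltn_ind: d => d IHd d4.
case: d d4 IHd => [//|[//|[//|[//|[|[|d]]]]]] _ IHd.
- exact/indep_kmax4/IHr.
- by apply: indep_kmax5; [|apply: IHr|apply: IHd].
by apply: indep_kmax6; [| |apply: IHr|apply: IHd|apply: IHd].
Qed.

End Main.

(** * Back to homogeneous polynomials *)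

Section EulerMpoly.
Variables (K : numFieldType) (n : nat).
Implicit Types (p : {mpoly K[n]}) (a : 'X_{1..n}) (v : 'I_n -> K).

Lemma mpoly_euler d p : p \is d.-homog -> \sum_j 'X_j * p^`M(j) = d%:R *: p.
Proof.
move=> /dhomogP hp.
transitivity (\sum_j \sum_(m <- msupp p) p@_m *: ('X_j * 'X_[m]^`M(j))).
  apply: eq_bigr => j _; rewrite {1}[p]mpolyE raddf_sum /= mulr_sumr.
  by apply: eq_bigr => m _; rewrite mderivZ scalerAr.
rewrite exchange_big /= [in RHS](mpolyE p) scaler_sumr; apply: eq_big_seq => m mp.
rewrite -scaler_sumr scalerA mulrC -scalerA; congr (_ *: _).
have <- : mdeg m = d := hp m mp.
rewrite mdegE natr_sum scaler_suml; apply: eq_bigr => j _.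
rewrite mderivX -scalerAr -mpolyXD.
have [->|mj] := posnP (m j); first by rewrite !scale0r.
congr (_ *: 'X_[_]); apply/mnmP => i; rewrite mnmDE mnmBE mnm1E.
by case: eqP => [<-|_]; lia.
Qed.

Lemma homog_mderivm d p a : p \is d.-homog -> p^`M[a] \is (d - mdeg a).-homog.
Proof.
move=> /dhomogP hp; apply/dhomogP => m; rewrite mcoeff_msupp mcoeff_mderivm => c0.
have : (a + m)%MM \in msupp p.
  by rewrite mcoeff_msupp; apply: contraNneq c0 => ->; rewrite mul0rn.
move/hp => amd; have <- : mdeg (a + m)%MM = d := amd.
by rewrite mdegD addKn.
Qed.

(** By Euler's identity a derivative of order below e, being homogeneous of positive degree, is a
    combination of derivatives of the next order. *)
Lemma mderivm_lower d p v e : p \is d.-homog -> (e <= d)%N ->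
  (forall a, mdeg a = e -> (p^`M[a]).@[v] = 0) ->
  forall a, (mdeg a <= e)%N -> (p^`M[a]).@[v] = 0.
Proof.
move=> hp ed top a /subnK; move: (e - mdeg a)%N => k.
elim: k a => [|k IH] a ae; first exact: top.
have /(congr1 (meval v)) := mpoly_euler (homog_mderivm a hp).
rewrite mevalZ raddf_sum big1 /= => [/esym/eqP|j _].
  by rewrite mulf_eq0 pnatr_eq0 => /orP[|/eqP //]; lia.
by rewrite mevalM -mderivmU1m -mderivmDm IH ?mulr0 // mdegD mdeg1; lia.
Qed.

End EulerMpoly.

Section Monomials.

Definition mnms n e : seq 'X_{1..n} := [seq s2m (val t) | t <- enum (basis n e)].

Lemma mem_mnms n e (a : 'X_{1..n}) : (a \in mnms n e) = (mdeg a == e).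
Proof. by rewrite basis_cover. Qed.

Lemma size_mnms r e : size (mnms r.+1 e) = 'C(e + r, e).
Proof. exact: size_basis. Qed.

Lemma uniq_mnms n e : uniq (mnms n e).
Proof. exact: uniq_basis. Qed.

Lemma mdeg_mnms n e (i : 'I_(size (mnms n e))) : mdeg (nth 0%MM (mnms n e) i) = e.
Proof. by apply/eqP; rewrite -mem_mnms mem_nth. Qed.

End Monomials.

Section Multihomog.
Variables (K : numFieldType) (n r : nat).
Implicit Types (p q : {mpoly K[n * r.+1]}) (e f : 'I_n -> nat).

Definition mhomog e p := forall a, a \in msupp p ->
  forall i, (\sum_(j < r.+1) a (mxvec_index i j))%N = e i.

Lemma mhomog_sum (I : Type) (s : seq I) (P : pred I) F e :
  (forall i, mhomog e (F i)) -> mhomog e (\sum_(i <- s | P i) F i).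
Proof.
move=> hF; elim/big_ind: _ => // [a|p q hp hq a]; first by rewrite msupp0.
by move/msuppD_le; rewrite mem_cat => /orP[/hp|/hq].
Qed.

Lemma mhomogZ c e p : mhomog e p -> mhomog e (c *: p).
Proof. by move=> hp a /msuppZ_le /hp. Qed.

Lemma mhomogM e f p q : mhomog e p -> mhomog f q -> mhomog (fun i => e i + f i)%N (p * q).
Proof.
move=> hp hq a /msuppM_le /allpairsP[[a1 a2] /= [/hp h1 /hq h2 ->]] i.
by rewrite -h1 -h2 -big_split; apply: eq_bigr => j _; rewrite mnmDE.
Qed.

Lemma mhomog_prod (I : Type) (s : seq I) F (e : I -> 'I_n -> nat) :
  (forall x, mhomog (e x) (F x)) -> mhomog (fun i => \sum_(x <- s) e x i)%N (\prod_(x <- s) F x).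
Proof.
move=> hF; elim: s => [|x s IH] a.
  by rewrite big_nil msupp1 inE => /eqP -> i; rewrite !big_nil big1 // => j _; rewrite mnm0E.
by rewrite big_cons => /(mhomogM (hF x) IH) h i; rewrite h big_cons.
Qed.

End Multihomog.

(** * The matrix of multiplicity conditions *)

Section Conditions.
Variables (K : numFieldType) (n r d : nat) (m : n.-tuple nat).
Hypothesis m_gt0 : forall i, (0 < tnth m i)%N.
Hypothesis m_le : forall i, ((tnth m i).-1 <= d)%N.

(* By Euler's identity the derivatives of order exactly [m_i - 1] suffice. *)
Definition cond := {i : 'I_n & 'I_(size (mnms r.+1 (tnth m i).-1))}.
Definition cmon (c : cond) : 'X_{1..r.+1} :=
  nth 0%MM (mnms r.+1 (tnth m (tag c)).-1) (tagged c).

Lemma mdeg_cmon c : mdeg (cmon c) = (tnth m (tag c)).-1.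
Proof. exact: mdeg_mnms. Qed.

Lemma cmonP i (a : 'X_{1..r.+1}) : mdeg a = (tnth m i).-1 ->
  exists2 c : cond, tag c = i & cmon c = a.
Proof.
move/eqP; rewrite -mem_mnms => am.
have lt : (index a (mnms r.+1 (tnth m i).-1) < size (mnms r.+1 (tnth m i).-1))%N.
  by rewrite index_mem.
exists (Tagged (fun i : 'I_n => 'I_(size (mnms r.+1 (tnth m i).-1))) (Ordinal lt)) => //.
by rewrite /cmon /= nth_index.
Qed.

Lemma card_cond : #|{: cond}| = (\sum_(i < n) 'C((r + tnth m i).-1, r))%N.
Proof.
rewrite card_tagged sumnE big_map big_enum; apply: eq_big => // i _.
rewrite card_ord size_mnms -bin_sub ?leq_addr // addKn.
by congr 'C(_, _); have := m_gt0 i; lia.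
Qed.

Definition dmon (b : 'I_(size (mnms r.+1 d))) : 'X_{1..r.+1} := nth 0%MM (mnms r.+1 d) b.

(** The matrix [condmx] for points with indeterminate coordinates; its entries are written out so
    that their multidegree is visible. *)
Definition condmxX : 'M[{mpoly K[n * r.+1]}]_(size (mnms r.+1 d), #|{: cond}|) :=
  \matrix_(b, y) let c := enum_val y in
    (\prod_l (dmon b l)^_(cmon c l))%:R *:
      \prod_(l < r.+1) 'X_(mxvec_index (tag c) l) ^+ (dmon b l - cmon c l).

Definition condmx (P : 'M[K]_(n, r.+1)) : 'M[K]_(size (mnms r.+1 d), #|{: cond}|) :=
  \matrix_(b, y) let c := enum_val y in
    ('X_[dmon b]^`M[cmon c]).@[fun j => row (tag c) P 0 j].

Lemma condmxXE P b y : (condmxX b y).@[fun k => mxvec P 0 k] = condmx P b y.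
Proof.
rewrite !mxE /= mderivmX !mevalZ mevalX; congr (_ * _); rewrite rmorph_prod.
by apply: eq_bigr => l _; rewrite rmorphXn /= mevalXU mxvecE mnmBE mxE.
Qed.

Lemma form_homog (u : 'rV[K]_(size (mnms r.+1 d))) :
  \sum_b u 0 b *: 'X_[dmon b] \is d.-homog.
Proof.
by apply: rpred_sum => b _; apply: rpredZ; rewrite dhomogX /= mdeg_mnms.
Qed.

Definition form u : dhomog r.+1 K d := DHomog (form_homog u).

Lemma mul_condmx u P y (c := enum_val y) :
  (u *m condmx P) 0 y = pderiv_at (cmon c) (row (tag c) P) (form u).
Proof.
rewrite mxE /pderiv_at /= raddf_sum /= raddf_sum /=; apply: eq_bigr => b _.
by rewrite mderivmZ mevalZ mxE.
Qed.

Lemma form_surj (F : dhomog r.+1 K d) : exists u, form u = F.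
Proof.
exists (\row_b (mpoly_of_dhomog F)@_(dmon b)); apply/val_inj => /=.
have /dhomogP hF := dhomog_is_dhomog F.
apply/mpolyP => a; rewrite raddf_sum /=.
have [da|da] := boolP (a \in mnms r.+1 d); last first.
  rewrite big1 => [|b _].
    apply/esym/eqP; rewrite mcoeff_eq0; apply: contra da => /hF ad.
    by rewrite mem_mnms; apply/eqP.
  rewrite mcoeffZ mcoeffX; case: eqP => [ba|]; last by rewrite mulr0.
  by rewrite -ba mem_nth in da.
have lt : (index a (mnms r.+1 d) < size (mnms r.+1 d))%N by rewrite index_mem.
rewrite (bigD1 (Ordinal lt)) //= big1 => [|b bne].
  by rewrite addr0 mcoeffZ mxE mcoeffX /dmon /= nth_index // eqxx mulr1.
rewrite mcoeffZ mcoeffX; case: eqP => [ba|]; last by rewrite mulr0.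
case/eqP: bne; apply: val_inj; rewrite /= -ba index_uniq //; exact: uniq_mnms.
Qed.

Definition cond_values (P : 'M[K]_(n, r.+1)) (F : dhomog r.+1 K d) : 'rV[K]_#|{: cond}| :=
  \row_y let c := enum_val y in pderiv_at (cmon c) (row (tag c) P) F.

Lemma cond_values_linear P : linear (cond_values P).
Proof. by move=> c F G; apply/rowP => y; rewrite !mxE; exact: pderiv_at_is_linear. Qed.

HB.instance Definition _ P := GRing.isLinear.Build K (dhomog r.+1 K d)
  'rV[K]_#|{: cond}| _ (cond_values P) (cond_values_linear P).

Lemma cond_values_form P u : cond_values P (form u) = u *m condmx P.
Proof. by apply/rowP => y; rewrite mul_condmx mxE. Qed.

Lemma linsys_cond_values P : linsys d m P = lker (linfun (cond_values P)).
Proof.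
apply/vspaceP => F; rewrite memv_ker lfunE /=; apply/idP/eqP => [/linsysP FP|F0].
  apply/rowP => y; rewrite !mxE /=; apply: FP.
  by rewrite mdeg_cmon ltn_predL.
apply/linsysP => i; rewrite /mult_at_least => a lta.
apply: (mderivm_lower (dhomog_is_dhomog F) (m_le i)); last by have := m_gt0 i; lia.
move=> a' /cmonP[c <- <-].
by have /rowP/(_ (enum_rank c)) := F0; rewrite !mxE /= enum_rankK.
Qed.

Lemma linsys_dim_surj P : row_full (condmx P) -> linsys_dim d m P = virtual_dim r d m.
Proof.
move=> full; rewrite /linsys_dim /virtual_dim linsys_cond_values.
have := limg_ker_dim (linfun (cond_values P)) fullv.
rewrite capfv; have -> : (linfun (cond_values P) @: fullv)%VS = fullv.
  apply/eqP; rewrite eqEsubv subvf /=; apply/subvP => w _.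
  have /submxP[u ->] : (w <= condmx P)%MS by apply: submx_full.
  by rewrite -cond_values_form -[cond_values P _](lfunE (cond_values P)) memv_img ?memvf.
have -> : \sum_(i < n) 'C((r + tnth m i).-1, r)%:Z = #|{: cond}|%:Z.
  by rewrite card_cond (big_morph Posz PoszD erefl).
rewrite !dimvf (_ : dim (dhomog r.+1 K d) = 'C(d + r, d)) //.
rewrite (_ : dim 'rV[K]_#|{: cond}| = #|{: cond}|); last by rewrite /dim /= mul1n.
rewrite -['C(d + r, d)]bin_sub ?leq_addr // addKn (addnC d) => /(congr1 Posz).
by rewrite PoszD => <-; ring.
Qed.

End Conditions.

(** * Openness of the maximal rank condition *)

Section Generic.
Variables (K : numFieldType) (n r d : nat) (m : n.-tuple nat).
Hypothesis m_gt0 : forall i, (0 < tnth m i)%N.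
Hypothesis m_le : forall i, ((tnth m i).-1 <= d)%N.

(* The exponents [dmon b - cmon c] are truncated; where truncation occurs the
   falling-factorial coefficient of the entry vanishes. *)
Lemma mhomog_condmxX b (y : 'I_#|{: cond r m}|) :
  mhomog (fun i => (tag (enum_val y) == i) * (d - (tnth m i).-1))%N (condmxX K r d m b y).
Proof.
rewrite mxE /=; set c := enum_val y.
have [le|/forallPn[l]] := boolP [forall l, (cmon c l <= dmon b l)%N]; last first.
  rewrite -ltnNge => lt; rewrite (bigD1 l) //= ffact_small // mul0n scale0r.
  by move=> a; rewrite msupp0.
apply: mhomogZ => a.
have -> : \prod_l 'X_(mxvec_index (tag c) l) ^+ (dmon b l - cmon c l) =
    'X_[\sum_l U_(mxvec_index (tag c) l) *+ (dmon b l - cmon c l)] :> {mpoly K[n * r.+1]}.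
  rewrite (big_morph _ (@mpolyXD _ K) (@mpolyX0 _ K)).
  by apply: eq_bigr => l _; rewrite mpolyXn.
rewrite msuppX inE => /eqP -> i.
have eqU l j : (U_(mxvec_index (tag c) l) *+ (dmon b l - cmon c l))%MM (mxvec_index i j) =
    ((tag c == i) * ((l == j) * (dmon b l - cmon c l)))%N.
  rewrite mulmnE mnm1E mulnA mulnb; congr (nat_of_bool _ * _)%N.
  apply/eqP/andP => [/cast_ord_inj/enum_rank_inj[/= -> ->]|[/eqP-> /eqP-> //]].
  by rewrite !eqxx.
transitivity (\sum_j \sum_l (tag c == i) * ((l == j) * (dmon b l - cmon c l)))%N.
  by apply: eq_bigr => j _; rewrite mnm_sumE; apply: eq_bigr => l _.
under eq_bigr do rewrite -big_distrr /=.
rewrite -big_distrr /=; have [<-|//] := eqVneq (tag c) i; congr (_ * _)%N.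
rewrite -(mdeg_cmon c) -[d in RHS](mdeg_mnms b) !mdegE -sumnB => [|l _]; last exact: (forallP le).
apply: eq_bigr => j _; rewrite (bigD1 j) //= eqxx mul1n big1 ?addn0 // => l /negPf ->.
by rewrite mul0n.
Qed.

Lemma non_special_surj (P0 : 'M[K]_(n, r.+1)) : is_config P0 ->
  row_full (condmx d m P0) -> -1 <= virtual_dim r d m -> non_special K r d m.
Proof.
move=> cP0 /row_fullP[L LP] v0.
(* [L] is a left inverse of the matrix at [P0], so [G] is a combination of maximal minors with value
   1 at [P0]. *)
pose G : {mpoly K[n * r.+1]} :=
  \det (map_mx (@mpolyC (n * r.+1) K) L *m condmxX K r d m).
have GE P : config_eval P G = \det (L *m condmx d m P).
  rewrite /config_eval /G -det_map_mx map_mxM; congr (\det (_ *m _)).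
    by apply/matrixP => i j; rewrite !mxE /= mevalC.
  by apply/matrixP => i j; rewrite -condmxXE [LHS]mxE.
exists (fun P => config_eval P G != 0); split.
- exists (fun G' => G' = G); split=> [_ ->|P _].
    rewrite /G /determinant.
    exists (fun i => \sum_(y : 'I_#|{: cond r m}|) (tag (enum_val y) == i) * (d - (tnth m i).-1))%N.
    apply: mhomog_sum => s.
    have -> : (-1) ^+ s = ((-1) ^+ s)%:MP_[n * r.+1] :> {mpoly K[n * r.+1]}.
      by rewrite rmorphXn rmorphN1.
    rewrite mul_mpolyC; apply: mhomogZ.
    (* Each term becomes a product over the columns, whose multidegrees do not depend on the
       permutation [s]. *)
    rewrite (reindex_inj (@perm_inj _ (s^-1)%g)).
    under eq_bigr do rewrite permKV.
    apply: mhomog_prod => y; rewrite mxE; apply: mhomog_sum => b.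
    by rewrite mxE mul_mpolyC; apply: mhomogZ; apply: mhomog_condmxX.
  split=> [/negP|/(_ G erefl) ->]; last by rewrite eqxx.
  by rewrite negbK => /eqP G0 _ ->.
- by exists P0; split=> //; rewrite GE LP det1 oner_eq0.
move=> P _; rewrite GE => d0; rewrite /expected_dim max_l // linsys_dim_surj //.
have : L *m condmx d m P \in unitmx by rewrite unitmxE unitfE.
move=> /mxrank_unit rk; rewrite -col_leq_rank.
by apply: leq_trans (mxrankM_maxr L _); rewrite rk.
Qed.

End Generic.

(** * From slab forms to a good configuration *)

Section Existence.
Variable K : numFieldType.

(** The injection [h] names the variables, so that the induction drops the newest one within a fixed
    polynomial ring. *)
Lemma slab_mono_monomial n r d (h : 'I_r.+1 -> 'I_n) : injective h ->
  forall b, exists a : 'X_{1..n},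
    [/\ slab_mono d (\row_j 'X_(h j) : 'rV[{mpoly K[n]}]_r.+1) b 0 = 'X_[a],
        mdeg a = d & (a (h ord_max) <= 1)%N].
Proof.
elim: r d h => [|r IHr] d h hI b.
  rewrite mxE mxE; case: d b => [|[|d]] [b ltb] //.
    by exists 0%MM; rewrite mpolyX0 mdeg0 mnm0E.
  exists U_(h ord0)%MM; split; rewrite ?mdeg1 //.
  by rewrite mnm1E; case: eqP.
elim: d b => [|d IHd] b.
  by exists 0%MM; rewrite mxE mpolyX0 mdeg0 mnm0E.
have hmax : h (lift ord0 ord_max) = h ord_max by congr h; apply: val_inj.
rewrite slab_monoS; case: (@split_ordP (slab_dim r d.+1) (slab_dim r.+1 d) b) => b' ->.
  rewrite col_mxEu.
  have [|a [aE da amax]] := IHr d.+1 (h \o lift ord0) _ b'.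
    by move=> i j /hI /lift_inj.
  exists a; split=> //; last by rewrite -hmax.
  rewrite -aE; congr (slab_mono _ _ _ _); apply/rowP => j.
  by rewrite row_tailE !mxE.
have [a [aE da amax]] := IHd b'.
exists (U_(h ord0) + a)%MM; split.
- by rewrite col_mxEd mxE mxE aE mpolyXD.
- by rewrite mdegD mdeg1 da.
by rewrite mnmDE mnm1E (inj_eq hI).
Qed.

Section SlabForm.
Variables (r d : nat) (c : 'rV[K]_(slab_dim r d)).

Definition slab_form : {mpoly K[r.+1]} :=
  (map_mx (@mpolyC r.+1 K) c *m slab_mono d (\row_j 'X_j)) 0 0.

Lemma slab_formE : slab_form = \sum_b c 0 b *: slab_mono d (\row_j 'X_j) b 0.
Proof. by rewrite /slab_form mxE; apply: eq_bigr => b _; rewrite mxE mul_mpolyC. Qed.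

Lemma slab_form_homog : slab_form \is d.-homog.
Proof.
rewrite slab_formE; apply: rpred_sum => b _; apply: rpredZ.
have [a [-> da _]] := @slab_mono_monomial r.+1 r d id (@inj_id _) b.
by rewrite dhomogX /= da.
Qed.

Lemma slab_form_coef (a : 'X_{1..r.+1}) : (1 < a ord_max)%N -> slab_form@_a = 0.
Proof.
move=> a1; rewrite slab_formE raddf_sum big1 //= => b _.
have [a' [-> _ a'1]] := @slab_mono_monomial r.+1 r d id (@inj_id _) b.
rewrite mcoeffZ mcoeffX; case: eqP => [e|]; last by rewrite mulr0.
by rewrite -e ltnNge a'1 in a1.
Qed.

Lemma slab_form_deriv (p : 'rV[K]_r.+1) l :
  (slab_form^`M(l)).@[fun j => p 0 j] = (c *m slab_jac d p) 0 l.
Proof.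
have dM (a b : {mpoly K[r.+1]}) : mderiv l (a * b) = mderiv l a * b + a * mderiv l b.
  exact: mderivM.
have dX : map_mx (mderiv l) (\row_j 'X_j : 'rV[{mpoly K[r.+1]}]_r.+1) = delta_mx 0 l.
  apply/rowP => j; rewrite !mxE mderivX mnm1E eqxx /=.
  case: eqP => [->|_]; last by rewrite scale0r.
  rewrite scale1r (_ : (U_(l) - U_(l))%MM = 0%MM) ?mpolyX0 //.
  by apply/mnmP => i; rewrite mnmBE subnn mnm0E.
have -> : slab_form^`M(l) =
    (map_mx (@mpolyC r.+1 K) c *m (slab_jac d (\row_j 'X_j) *m (delta_mx 0 l : 'rV_r.+1)^T)) 0 0.
  rewrite -dX -(slab_mono_deriv (D := mderiv l) dM) slab_formE raddf_sum mxE.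
  by apply: eq_bigr => b _; rewrite /= mderivZ !mxE mul_mpolyC.
rewrite trmx_delta mulmxA -colE mxE.
pose ev := meval (fun j => p 0 j) : {mpoly K[r.+1]} -> K.
have pE : map_mx ev (\row_j 'X_j) = p by apply/rowP => j; rewrite !mxE /ev mevalXU.
have cE : map_mx ev (map_mx (@mpolyC r.+1 K) c) = c.
  by apply/rowP => j; rewrite !mxE /ev mevalC.
by rewrite -[in RHS]pE -map_slab_jac -[c in RHS]cE -map_mxM [RHS]mxE.
Qed.

End SlabForm.

Lemma meval_coord n d (H : {mpoly K[n]}) x : H \is d.-homog ->
  H.@[fun j => (j == x)%:R] = H@_(U_(x) *+ d).
Proof.
move=> /dhomogP hH; rewrite mevalE.
have prodE a : a \in msupp H -> \prod_i (i == x)%:R ^+ a i = (a == U_(x) *+ d)%MM%:R :> K.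
  move=> aH; have da : mdeg a = d := hH a aH.
  case: eqP => [->|ne].
    rewrite big1 // => i _; rewrite mulmnE mnm1E eq_sym.
    by case: eqP; rewrite ?mul0n ?expr0 // expr1n.
  have [i /andP[/negPf ix ai]] : exists i, (i != x) && (a i != 0%N).
    apply/existsP; apply: contra_notT ne; rewrite negb_exists => /forallP a0.
    have {}a0 i : i != x -> a i = 0%N.
      by move=> ix; apply/eqP; have := a0 i; rewrite ix /= negbK.
    apply/mnmP => i; rewrite mulmnE mnm1E eq_sym.
    case: eqP => [->|/eqP ix]; last by rewrite mul0n a0.
    by rewrite mul1n -da mdegE (bigD1 x) //= big1 ?addn0 // => j /a0.
  by rewrite (bigD1 i) //= ix expr0n (negPf ai) mul0r.
have [aH|aH] := boolP ((U_(x) *+ d)%MM \in msupp H); last first.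
  rewrite (memN_msupp_eq0 aH) big1_seq // => a /andP[_ a_in].
  by rewrite prodE //; case: eqP => [e|]; rewrite ?mulr0 // -e a_in in aH *.
rewrite (bigD1_seq _ aH (msupp_uniq H)) /= prodE // eqxx mulr1 big1_seq ?addr0 //.
by move=> a /andP[/negPf ne a_in]; rewrite prodE // ne mulr0.
Qed.

Lemma cmon_inj n r (m : n.-tuple nat) (c c' : cond r m) :
  tag c = tag c' -> cmon c = cmon c' -> c = c'.
Proof.
case: c c' => [i x] [i' x'] /= ii; case: i' / ii x' => x'.
rewrite /cmon /= => /eqP; rewrite nth_uniq ?uniq_mnms // => /eqP/ord_inj -> //.
Qed.

End Existence.

Lemma tnth_mults0 d k : tnth (mults d k) ord0 = d.-1.
Proof. by rewrite (tnth_nth 0%N). Qed.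

Lemma tnth_multsS d k i : tnth (mults d k) (lift ord0 i) = 2%N.
Proof. by rewrite (tnth_nth 0%N) /= nth_nseq ltn_ord. Qed.

(** The derivative is a quadric, whose value at the coordinate point is its coefficient of x0^2. *)
Lemma mderivm_coord (K : numFieldType) r e (F : {mpoly K[r.+1]}) a :
  F \is (e.+2).-homog -> mdeg a = e ->
  (F^`M[a]).@[fun j => (j == ord_max)%:R] =
  F@_(a + U_(ord_max) *+ 2) *+ \prod_i ((a + U_(ord_max) *+ 2)%MM i)^_(a i).
Proof.
move=> hF da; have := homog_mderivm a hF; rewrite da -addn2 addKn => /meval_coord ->.
by rewrite mcoeff_mderivm.
Qed.

(** The system is triangular: the conditions at the coordinate point see only the coefficients of
    monomials divisible by x0^2, which [F1] fits; a slab form then corrects the gradients at the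
    double points without affecting them. *)
Lemma indep_condmx (K : numFieldType) r e k : indep_points K r e.+2 k ->
  exists P : 'M[K]_(k.+1, r.+1), is_config P /\ row_full (condmx e.+2 (mults e.+2 k) P).
Proof.
move=> [P sP]; pose x0 : 'I_r.+1 := ord_max.
pose top : 'rV[K]_r.+1 := \row_j (j == x0)%:R.
pose Q : 'M[K]_(k.+1, r.+1) := col_mx top P.
have Q0 : row ord0 Q = top.
  have -> : ord0 = lshift k 0 :> 'I_(1 + k) by apply: val_inj.
  by rewrite -[RHS](row_1id top 0); apply: (row_colU top P 0).
have QS i : row (lift ord0 i) Q = row i P.
  have -> : lift ord0 i = rshift 1 i :> 'I_(1 + k) by apply: val_inj.
  exact: (row_colD top P i).
exists Q; split=> [i|].
  case: (unliftP ord0 i) => [j|] ->.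
    rewrite QS; apply/eqP => p0; have [c /(_ j)] := sP (const_mx 1).
    rewrite p0 slab_jac_at0 mulmx0 => /rowP/(_ 0); rewrite !mxE => /esym/eqP.
    by rewrite oner_eq0.
  rewrite Q0; apply/eqP => /rowP/(_ x0); rewrite !mxE eqxx => /eqP.
  by rewrite oner_eq0.
rewrite -col_leq_rank; apply/row_full_surj => w.
pose T := cond r (mults e.+2 k).
(* The factor by which differentiation multiplies the coefficient, nonzero in characteristic 0. *)
pose cst (a : 'X_{1..r.+1}) : K := (\prod_i ((a + U_(x0) *+ 2)%MM i)^_(a i))%:R.
have cst0 a : cst a != 0.
  rewrite pnatr_eq0 -lt0n; apply: prodn_gt0 => i.
  by rewrite ffact_gt0 mnmDE leq_addr.
pose F1 : {mpoly K[r.+1]} := \sum_(c : T | tag c == ord0)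
  (w 0 (enum_rank c) / cst (cmon c)) *: 'X_[cmon c + U_(x0) *+ 2].
have hF1 : F1 \is (e.+2).-homog.
  apply: rpred_sum => c /eqP c0; apply: rpredZ; rewrite dhomogX /= mdegD mdegMn mdeg1.
  by rewrite mdeg_cmon c0 tnth_mults0 addn2.
pose W : 'M[K]_(k, r.+1) := \matrix_(i, l)
  (if [pick c : T | (tag c == lift ord0 i) && (cmon c == U_(l)%MM)] is Some c
   then w 0 (enum_rank c) - (F1^`M(l)).@[fun j => P i j] else 0).
have [c0 c0P] := sP W.
pose F := F1 + slab_form c0.
have hF : F \is (e.+2).-homog by apply: rpredD => //; apply: slab_form_homog.
have [u uF] := form_surj (DHomog hF).
exists u; rewrite -cond_values_form uF; apply/rowP => y; rewrite mxE /= /pderiv_at /=.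
set c := enum_val y; have yE : y = enum_rank c by rewrite enum_valK.
case: (unliftP ord0 (tag c)) => [i|] ci.
  have dc : mdeg (cmon c) = 1%N by rewrite mdeg_cmon ci tnth_multsS.
  have /eqP/mdeg1P [l /eqP cl] := dc.
  rewrite ci QS cl mderivmU1m mderivD mevalD.
  have := slab_form_deriv c0 (row i P) l.
  rewrite c0P !mxE; case: pickP => [c' /andP[/eqP tc' /eqP mc']|/(_ c)]; last first.
    by rewrite ci cl !eqxx.
  have -> : c' = c by apply: cmon_inj; rewrite ?tc' ?mc'.
  move=> ->; rewrite yE addrC -/c.
  rewrite (_ : meval (fun j => row i P 0 j) _ = (F1^`M(l)).@[fun j => P i j]) ?subrK //.
  by apply: meval_eq => j; rewrite mxE.
rewrite ci Q0.
rewrite (_ : meval _ _ = (F^`M[cmon c]).@[fun j => (j == x0)%:R]); last first.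
  by apply: meval_eq => j; rewrite mxE.
rewrite (@mderivm_coord _ _ e) //; last by rewrite mdeg_cmon ci tnth_mults0.
rewrite mcoeffD slab_form_coef ?addr0; last first.
  by rewrite mnmDE mulmnE mnm1E eqxx addnC.
rewrite raddf_sum (bigD1 c) /= ?ci // big1 ?addr0 => [|c' /andP[/eqP c'0 ne]].
  by rewrite mcoeffZ mcoeffX eqxx mulr1 -mulr_natr divfK ?cst0 // yE.
rewrite mcoeffZ mcoeffX; case: eqP => [/addIm e'|]; last by rewrite mulr0.
by case/eqP: ne; apply: cmon_inj; rewrite ?c'0 ?ci.
Qed.

(** The monomials missing from the slab are x0^2 times those of degree [d]. *)
Lemma slab_dim_binomial r d : (slab_dim r d.+2 + 'C(r + d, r) = 'C(r + d.+2, r))%N.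
Proof.
elim: r d => [|r IHr] d; first by rewrite !bin0.
have pascal n : 'C(r.+1 + n.+1, r.+1) = ('C(r.+1 + n, r.+1) + 'C(r + n.+1, r))%N.
  by rewrite addnS binS [in X in (_ + X)%N]addSnnS.
elim: d => [|d IHd]; rewrite slab_dimS.
  have := IHr 0%N; rewrite slab_dim_deg1 !addn0 !binn (pascal 1%N) => h.
  by rewrite (addn1 r.+1) binSn; lia.
by have := IHr d.+1; rewrite (pascal d) (pascal d.+2); lia.
Qed.

Theorem proposition2p9 (R : realType) (r d k : nat)
    (hr : (3 <= r)%N) (hd : (4 <= d)%N) (hk : k%:Z <= k_bound r d) :
  non_special R[i]%C r d (mults d k) /\ -1 <= virtual_dim r d (mults d k).
Proof.
case: d hd hk => [//|[//|e]] hd hk.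
have Pe := slab_dim_binomial r e.
have kle : ((k + (r - 2)) * r.+1 <= slab_dim r e.+2)%N.
  move: hk; rewrite /k_bound lerBrDr real_floor_ge_int ?num_real //.
  have -> : (k%:Z + (r%:Z - 2)) = (k + (r - 2))%N%:Z by lia.
  rewrite -mulrBr mulrC ler_pdivlMr ?ltr0n // -Pe (_ : r + e.+2 - 2 = r + e)%N; last lia.
  rewrite natrD addrK -natrM ler_nat.
  by [].
(* The first point imposes as many conditions as there are monomials outside the slab, so the
   virtual dimension is [slab_dim r e.+2] - 1 - k(r+1). *)
have v0 : -1 <= virtual_dim r e.+2 (mults e.+2 k).
  rewrite /virtual_dim big_ord_recl tnth_mults0.
  rewrite (eq_bigr (fun=> r.+1%:Z)) => [|i _]; last first.
    by rewrite tnth_multsS addn2 /= binSn.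
  rewrite sumr_const card_ord -Pe (_ : (r + e.+2.-1).-1 = r + e)%N; last lia.
  have : (k * r.+1 <= slab_dim r e.+2)%N by apply: leq_trans kle; rewrite leq_mul2r leq_addr orbT.
  lia.
split=> //.
have kmaxk : (k <= kmax r e.+2)%N.
  rewrite /kmax; have : (k + (r - 2) <= slab_dim r e.+2 %/ r.+1)%N by rewrite leq_divRL.
  lia.
have [P [cP fP]] := indep_condmx (indep_points_le kmaxk (@indep_kmax R[i]%C r e.+2 (ltnW hr) hd)).
apply: non_special_surj cP fP v0 => i; case: (unliftP ord0 i) => [j|] ->.
- by rewrite tnth_multsS.
- by rewrite tnth_mults0.
- by rewrite tnth_multsS.
by rewrite tnth_mults0 /=; lia.
Qed.
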